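(* Let $\varepsilon(n)=\frac{16(\log n)^{0.8}}{n}$. If $p=p(n)\ge\frac{4\log n}{n}+\varepsilon(n)$, then a random temporal graph from $\mathcal H_{n,p}$ a.a.s. has an optimal spanner, i.e., a temporal spanner with exactly $2n-4$ edge labels in total.
   Context: A temporal graph is a pair $(G,\lambda)$ with $G=(V,E)$ a finite simple undirected graph and $\lambda$ assigning to each edge a finite set of time labels. A temporal $(u,v)$-path is a path $u=u_0,\dots,u_\ell=v$ in $G$ together with labels $\lambda_i\in\lambda(u_{i-1}u_i)$ satisfying $\lambda_1\le\dots\le\lambda_\ell$. A temporal graph is temporally connected if every vertex has a temporal path to every other vertex. A temporal subgraph $(G',\lambda')$ of $(G,\lambda)$ has $G'$ a subgraph of $G$ and $\lambda'(e)\subseteq\lambda(e)$; a temporal spanner is a temporally connected temporal subgraph with $V(G')=V(G)$, and its number of edge labels is $\sum_{e\in E(G')}|\lambda'(e)|$. The random model $\mathcal H_{n,p}$: on $n$ labelled vertices, for each of the $\binom n2$ pairs independently, the set of time labels of that pair is given by a Poisson point process of rate $1$ on $[0,p]$; the underlying graph consists of the pairs receiving at least one label. $\log$ is the natural logarithm; a.a.s. means with probability tending to $1$ as $n\to\infty$. *)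

(* Defs.v *)
From HB Require Import structures.
From mathcomp Require Import all_boot all_order all_algebra finmap.
From mathcomp Require Import all_classical all_reals all_analysis.

Set Implicit Arguments.
Unset Strict Implicit.
Unset Printing Implicit Defensive.

Import Order.TTheory GRing.Theory Num.Theory.
Import numFieldNormedType.Exports.

Local Open Scope classical_set_scope.
Local Open Scope ring_scope.

Notation vpair V := {e : {set V} | #|e| == 2%N}.

(* The vertex set is the whole type V; [tlabel] is only meaningful on the pairs
   in [tedges]. *)
Record tgraph (R : realType) (V : finType) := TGraph {
  tedges : {set vpair V} ;
  tlabel : vpair V -> {fset R} }.

Section TemporalGraph.
Context {R : realType} {V : finType}.
Implicit Types G S : tgraph R V.

(* The vertices of the path are u :: w, and t`_i labels its i-th edge. *)
Definition temporal_path G (u v : V) (w : seq V) (t : seq R) : Prop :=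
  [/\ size t = size w,
      uniq (u :: w),
      last u w = v,
      sorted <=%R t &
      forall i, (i < size w)%N ->
        exists2 e : vpair V, e \in tedges G &
          val e = [set nth u (u :: w) i; nth u w i]%SET /\
          t`_i \in tlabel G e].

Definition temporally_connected G : Prop :=
  forall u v : V, u != v -> exists w t, temporal_path G u v w t.

(* Both graphs have vertex set V, so these are the temporal subgraphs with
   V(G') = V(G). *)
Definition spanning_tsubgraph S G : Prop :=
  tedges S \subset tedges G /\
  forall e, e \in tedges S -> (tlabel S e `<=` tlabel G e)%fset.

Definition temporal_spanner S G : Prop :=
  spanning_tsubgraph S G /\ temporally_connected S.

Definition num_labels G : nat := (\sum_(e in tedges G) #|` tlabel G e|)%N.

Definition has_optimal_spanner G : Prop :=
  exists S, temporal_spanner S G /\ num_labels S = (2 * #|V| - 4)%N.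

Definition tgraph_of_labels (l : vpair V -> {fset R}) : tgraph R V :=
  TGraph [set e | l e != fset0]%SET l.

End TemporalGraph.

Section PointProcess.
Context {R : realType} (d : measure_display) (T : measurableType d)
  (P : probability T R).

Definition mutually_independent (I : finType) (F : I -> set (set T)) : Prop :=
  forall (J : {set I}) (A : I -> set T),
    (forall i, i \in J -> F i (A i)) ->
    P (\bigcap_(i in [set` J]) A i) = (\prod_(i in J) P (A i))%E.

Definition npoints (X : T -> {fset R}) (B : set R) (x : T) : nat :=
  #|` [fset y in X x | y \in B]%fset|.

(* The second argument of [poisson_prob] is not used in its definition. *)
Definition poisson_process (rate : R) (D : set R) (X : T -> {fset R}) : Prop :=
  [/\ forall x y, y \in X x -> D y,
      forall B, measurable B -> B `<=` D ->
        measurable_fun setT (npoints X B),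
      forall B, measurable B -> B `<=` D -> forall K : set nat,
        P (npoints X B @^-1` K) =
        poisson_prob (rate * fine (lebesgue_measure B)) 0 K &
      forall (m : nat) (B : 'I_m -> set R),
        (forall i, measurable (B i)) -> (forall i, B i `<=` D) ->
        trivIset setT B ->
        mutually_independent
          (fun i => [set npoints X (B i) @^-1` K | K in [set: set nat]])].

Definition process_sigma_algebra (D : set R) (X : T -> {fset R}) :
    set (set T) :=
  <<s [set A | exists2 B, measurable B /\ B `<=` D &
               exists K : set nat, A = npoints X B @^-1` K] >>.

(* The family L w, for w in the sample space, of label sets of the pairs has
   the law of the labels in H_{n,p}. *)
Definition random_labels_H (n : nat) (p : R)
    (L : T -> vpair 'I_n -> {fset R}) : Prop :=
  (forall e, poisson_process 1 `[0, p] (L^~ e)) /\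
  mutually_independent (fun e => process_sigma_algebra `[0, p] (L^~ e)).

End PointProcess.

(* Measurability is part of the definition because a measure may take
   arbitrary values on non-measurable sets. *)
Definition aas (R : realType) (d : nat -> measure_display)
    (T : forall n, measurableType (d n)) (P : forall n, probability (T n) R)
    (E : forall n, set (T n)) : Prop :=
  (forall n, measurable (E n)) /\ P n (E n) @[n --> \oo] --> 1%E.

Definition eps (R : realType) (n : nat) : R :=
  16 * (ln n%:R) `^ (8 / 10) / n%:R.

(* Main.v *)
Require Import Defs.
From HB Require Import structures.
From mathcomp Require Import all_boot all_order all_algebra finmap.
From mathcomp Require Import all_classical all_reals all_analysis.
From mathcomp Require Import ring lra zify.

Import Order.TTheory GRing.Theory Num.Theory.
Import numFieldNormedType.Exports.

Set Implicit Arguments.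
Unset Strict Implicit.
Unset Printing Implicit Defensive.

Local Open Scope classical_set_scope.
Local Open Scope ring_scope.

(** An optimal spanner is obtained from the gossip scheme: gather at the
    vertices of a 4-cycle along n - 4 labels, let the 4-cycle exchange
    everything with 4 labels ([ab], [cd], then [bc], [da]), and broadcast along
    n - 4 further labels. With l = (log n)^0.8, cut [0, p] into a gathering
    window of length (2 log n + 6 l) / n, four windows of length l / n, one for
    each edge of the cycle, and a broadcasting window of length
    (2 log n + 6 l) / n; the labels in distinct windows are independent.

    A 4-cycle with its edges in the four short windows exists a.a.s. by the
    second moment method. Broadcasting from a set of size k (and, in reversed
    time, gathering at it) reaches a new vertex at rate k (n - k), and
    (n - k) / (k - 1) is an eigenfunction of this chain with eigenvalue
    - (n - 1): its expectation starts below n, and it is at least 1 / n as long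
    as some vertex is missing, so a time slightly above 2 log n / n suffices.
    To keep everything finite, the gathering and broadcasting windows are cut
    into 8 n^3 cells, each of which is used for at most one new vertex.

    The event is measurable because it only depends on the relative order of
    the labels: it is the lower limit of the same events for labels rounded to
    a grid of mesh 1 / N, and these depend on countably many cell counts. *)

(** * Time-respecting walks and their reduction to temporal paths *)

Section TemporalWalks.
Context {R : realType} {V : finType}.
Implicit Types (l : vpair V -> {fset R}) (u v w : V) (lo hi t : R).

Definition ledge l u v t : Prop :=
  exists2 e : vpair V, val e = [set u; v]%SET & t \in l e.

Lemma ledge_sym l u v t : ledge l u v t -> ledge l v u t.
Proof. by case=> e ee te; exists e => //; rewrite finset.setUC. Qed.

(** Walks rather than paths, so that concatenation need not care about repeated vertices. The first
    index rises to the label just used, which makes the labels nondecreasing. *)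
Inductive treach l : R -> R -> V -> V -> Prop :=
| treach_refl lo hi u : treach l lo hi u u
| treach_step lo hi t u w v : lo <= t -> t <= hi -> ledge l u w t ->
    treach l t hi w v -> treach l lo hi u v.

Lemma treach_weaken l lo lo' hi u v :
  lo' <= lo -> treach l lo hi u v -> treach l lo' hi u v.
Proof.
move=> lolo uv; case: lo hi u v / uv lolo => [lo hi u|lo hi t u w v lot thi uw wv] lolo.
  exact: treach_refl.
exact: treach_step (le_trans lolo lot) thi uw wv.
Qed.

Lemma treach_cat l lo m hi u v w : lo <= m -> m <= hi ->
  treach l lo m u v -> treach l m hi v w -> treach l lo hi u w.
Proof.
move=> lom mhi uv; elim: uv w lom mhi => {lo m u v}.
  by move=> lo m u w lom mhi; exact: treach_weaken.
move=> lo m t u x v lot tm ux xv IH w lom mhi vw.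
by apply: (treach_step lot (le_trans tm mhi) ux); exact: IH.
Qed.

Lemma treach1 l lo hi t u v : lo <= t -> t <= hi -> ledge l u v t ->
  treach l lo hi u v.
Proof. by move=> lot thi uv; apply: (treach_step lot thi uv); exact: treach_refl. Qed.

Lemma treach_mono l l' lo hi u v : (forall e, l e `<=` l' e)%fset ->
  treach l lo hi u v -> treach l' lo hi u v.
Proof.
move=> ll'; elim=> {lo hi u v} [*|lo hi t u w v lot thi [e ee te] _ IH].
  exact: treach_refl.
by apply: (treach_step lot thi _ IH); exists e => //; exact: (fsubsetP (ll' e)).
Qed.

Lemma treach_weakenr l lo hi hi' u v :
  hi <= hi' -> treach l lo hi u v -> treach l lo hi' u v.
Proof.
move=> + uv; elim: uv => {lo hi u v} [*|lo hi t u w v lot thi uw _ IH hh].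
  exact: treach_refl.
by apply: (treach_step lot (le_trans thi hh) uw); exact: IH.
Qed.

(* If [u] recurs on the path from its successor, the path is cut down to its
   part after that occurrence. *)
Lemma treach_temporal_path l lo hi u v : treach l lo hi u v ->
  exists ws ts, temporal_path (tgraph_of_labels l) u v ws ts /\
    all (fun t => lo <= t) ts.
Proof.
elim=> {lo hi u v} [lo hi u|lo hi t u w v lot thi [e ee te] _ [ws [ts []]]].
  by exists [::], [::]; split.
move=> [sz un la so ed] al.
have [uw|uw] := boolP (u \in w :: ws); last first.
  exists (w :: ws), (t :: ts); split; last first.
    by rewrite /= lot; apply: sub_all al => s; exact: le_trans.
  split => //=.
  - by rewrite sz.
  - by rewrite uw.
  - by rewrite (path_sortedE le_trans) so al.
  - move=> [|i] /= iw.
      exists e => //; rewrite inE; apply/fset0Pn; by exists t.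
    case: (ed i iw) => e' e'E [ee' te']; exists e' => //; split=> //.
    by rewrite ee' (set_nth_default w) ?(set_nth_default w u) //= ltnW.
pose k := index u (w :: ws).
have kw : (k <= size ws)%N by move: uw; rewrite -index_mem.
have uE : u = nth u (w :: ws) k by rewrite nth_index.
have dE : u :: drop k ws = drop k (w :: ws).
  by rewrite [in RHS](drop_nth u) ?ltnS // -uE.
exists (drop k ws), (drop k ts); split; last first.
  by apply/allP => s /mem_drop sts; apply: (le_trans lot); exact: (allP al).
split => //.
- by rewrite !size_drop sz.
- by rewrite dE; exact: drop_uniq.
- rewrite -la -[last u _]/(last u (u :: drop k ws)) dE -[last w ws]/(last u (w :: ws)).
  by rewrite -[in RHS](cat_take_drop k (w :: ws)) last_cat -dE.
- exact: drop_sorted.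
- move=> i; rewrite size_drop => iw.
  have kiw : (k + i < size ws)%N by lia.
  case: (ed _ kiw) => e' e'E [ee' te']; exists e' => //.
  rewrite dE !nth_drop; split => //.
  by rewrite ee' (set_nth_default w) ?(set_nth_default w u) //= ltnW.
Qed.

End TemporalWalks.

(** * Partial spanners from a set of sources to a set of targets *)

Section PartialSpanners.
Context {R : realType} {V : finType}.
Implicit Types (l L : vpair V -> {fset R}) (u v w : V) (lo hi t : R).
Implicit Types (A B : {set V}).

Definition nlabels l : nat := (\sum_e #|` l e|)%N.

Lemma num_labels_of_labels l : num_labels (tgraph_of_labels l) = nlabels l.
Proof.
rewrite /num_labels /nlabels [RHS](bigID (fun e => l e != fset0)) /=.
rewrite [X in (_ + X)%N]big1 ?addn0; last by move=> e /negPn/eqP ->; rewrite cardfs0.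
by apply: eq_bigl => e; rewrite inE.
Qed.

Definition add_label l (e : vpair V) t : vpair V -> {fset R} :=
  fun e' => if e' == e then (t |` l e')%fset else l e'.

Lemma add_label_sub l e t e' : (l e' `<=` add_label l e t e')%fset.
Proof. by rewrite /add_label; case: ifP => _; rewrite ?fsubsetU1. Qed.

Lemma nlabels_add_label l e t : t \notin l e ->
  nlabels (add_label l e t) = (nlabels l).+1.
Proof.
move=> te; rewrite /nlabels (bigD1 e) //= [in RHS](bigD1 e) //= /add_label eqxx.
rewrite cardfsU1 te -addSn add1n; congr addn.
by apply: eq_bigr => e' /negPf ->.
Qed.

Lemma ledge_add_label l e t u v : val e = [set u; v]%SET ->
  ledge (add_label l e t) u v t.
Proof. by move=> ee; exists e => //; rewrite /add_label eqxx fset1U1. Qed.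

(** The interval is half-open, so a label at or after [hi], or before [lo], is certainly new. This
    keeps the count exact when labels are added at either end. *)
Definition labels_in L l lo hi k : Prop :=
  [/\ lo <= hi, nlabels l = k, forall e, (l e `<=` L e)%fset &
      forall e t, t \in l e -> lo <= t < hi].

Lemma labels_in0 L lo hi : lo <= hi -> labels_in L (fun=> fset0) lo hi 0.
Proof.
by move=> lohi; split=> //; rewrite /nlabels big1 // => e _; rewrite cardfs0.
Qed.

Lemma labels_in_addr L l lo hi k e t x y : labels_in L l lo hi k ->
  hi <= x -> x <= t < y -> t \in L e ->
  labels_in L (add_label l e t) lo y k.+1.
Proof.
move=> [lohi nk lL lin] hix /andP[xt ty] te.
have hiy : hi <= y by apply: (le_trans hix); apply/ltW/(le_lt_trans xt).
split.
- exact: le_trans hiy.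
- rewrite nlabels_add_label ?nk //; apply/negP => /lin /andP[_].
  by rewrite ltNge (le_trans hix xt).
- move=> e'; rewrite /add_label; case: eqP => [->|//].
  by rewrite fsubUset fsub1set te lL.
- move=> e' s; rewrite /add_label; case: eqP => [->|_]; rewrite ?inE.
    case/orP => [/eqP ->|/lin /andP[-> shi]] /=; last exact: lt_le_trans hiy.
    by rewrite ty andbT; exact: le_trans (le_trans lohi hix) xt.
  by move/lin => /andP[-> shi] /=; exact: lt_le_trans hiy.
Qed.

Lemma labels_in_addl L l lo hi k e t x y : labels_in L l lo hi k ->
  y <= lo -> x <= t < y -> t \in L e ->
  labels_in L (add_label l e t) x hi k.+1.
Proof.
move=> [lohi nk lL lin] ylo /andP[xt ty] te.
have xlo : x <= lo by apply: (le_trans xt); apply/ltW/(lt_le_trans ty).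
split.
- exact: le_trans lohi.
- rewrite nlabels_add_label ?nk //; apply/negP => /lin /andP[+ _].
  by rewrite leNgt (lt_le_trans ty ylo).
- move=> e'; rewrite /add_label; case: eqP => [->|//].
  by rewrite fsubUset fsub1set te lL.
- move=> e' s; rewrite /add_label; case: eqP => [->|_]; rewrite ?inE.
    case/orP => [/eqP ->|/lin /andP[los ->]]; last by rewrite (le_trans xlo).
    by rewrite xt (lt_le_trans ty) // (le_trans ylo).
  by move/lin => /andP[los ->]; rewrite (le_trans xlo).
Qed.

(** The invariant of the construction: the count is 4 when both sets are the 4-cycle, each vertex
    added to either set costs one label, and the count ends at 2n - 4. The subtraction is truncated,
    hence the bounds by 4 in the extension lemmas. *)
Definition partial_spanner L A B lo hi : Prop :=
  exists2 l, labels_in L l lo hi (#|A| + #|B| - 4) &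
    forall u v, u \in A -> v \in B -> treach l lo hi u v.

Lemma partial_spanner_weaken L A B lo hi lo' hi' : lo' <= lo -> hi <= hi' ->
  partial_spanner L A B lo hi -> partial_spanner L A B lo' hi'.
Proof.
move=> ll hh [l [lohi nk lL lin] r]; exists l.
  split=> //; first exact: le_trans (le_trans ll lohi) hh.
  by move=> e t /lin /andP[a b]; rewrite (le_trans ll a) (lt_le_trans b hh).
by move=> u v uA vB; apply/(treach_weaken ll)/(treach_weakenr hh)/r.
Qed.

(** Every walk from [A] to [u] ends by time [hi], so the later label [t] extends it to [v]. *)
Lemma partial_spanner_out L A B lo hi u v e t x y :
  (4 <= #|A| + #|B|)%N -> partial_spanner L A B lo hi ->
  u \in B -> v \notin B -> val e = [set u; v]%SET -> t \in L e ->
  hi <= x -> x <= t < y ->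
  partial_spanner L A (v |: B)%SET lo y.
Proof.
move=> c4 [l lin r] uB vB ee te hix xty; exists (add_label l e t).
  rewrite cardsU1 vB add1n addnS subSn //.
  exact: labels_in_addr lin hix xty te.
have [lohi _ _ _] := lin; case/andP: xty => xt ty.
have hit := le_trans hix xt; have lot := le_trans lohi hit.
move=> a b aA; rewrite 2!inE => /orP[/eqP ->|bB].
  apply: (treach_cat lot (ltW ty) (v := u)).
    apply: (treach_weakenr hit); apply: (treach_mono (add_label_sub l e t)).
    exact: r.
  by apply: (treach1 (lexx t) (ltW ty)); exact: ledge_add_label.
apply: (treach_weakenr (le_trans hit (ltW ty))).
by apply: (treach_mono (add_label_sub l e t)); exact: r.
Qed.

(** The time reversal of the previous extension: the new label is earlier than all others and leads
    from [v] into [u]. *)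
Lemma partial_spanner_in L A B lo hi u v e t x y :
  (4 <= #|A| + #|B|)%N -> partial_spanner L A B lo hi ->
  u \in A -> v \notin A -> val e = [set u; v]%SET -> t \in L e ->
  y <= lo -> x <= t < y ->
  partial_spanner L (v |: A)%SET B x hi.
Proof.
move=> c4 [l lin r] uA vA ee te ylo xty; exists (add_label l e t).
  rewrite cardsU1 vA add1n addSn subSn //.
  exact: labels_in_addl lin ylo xty te.
have [lohi _ _ _] := lin; case/andP: xty => xt ty.
have tlo := le_trans (ltW ty) ylo; have thi := le_trans tlo lohi.
move=> a b; rewrite 2!inE => /orP[/eqP ->|aA] bB.
  apply: (treach_step xt thi (w := u)).
    by apply/ledge_sym; exact: ledge_add_label.
  apply: (treach_weaken tlo); apply: (treach_mono (add_label_sub l e t)).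
  exact: r.
apply: (treach_weaken (le_trans xt tlo)).
by apply: (treach_mono (add_label_sub l e t)); exact: r.
Qed.

Lemma partial_spanner_full L lo hi : partial_spanner L [set: V]%SET [set: V]%SET lo hi ->
  has_optimal_spanner (tgraph_of_labels L).
Proof.
move=> [l [lohi nk lL lin] r]; exists (tgraph_of_labels l); split; last first.
  by rewrite num_labels_of_labels nk cardsT; lia.
split; first split => //.
- apply/fintype.subsetP => e; rewrite !inE; apply: contraNneq => Le.
  by rewrite -fsubset0 -Le lL.
- move=> u v _; have [ws [ts [p _]]] :=
    treach_temporal_path (r u v (finset.in_setT u) (finset.in_setT v)).
  by exists ws, ts.
Qed.

(** Neighbours on the cycle use one label. The diagonals use an early label followed by a late one:
    a to c by ab, bc; c to a by cd, da; b to d by ab, da; d to b by cd, bc. *)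
Lemma partial_spanner_cycle L (a b c d : V)
    (eab ecd ebc eda : vpair V) (t1 t2 t3 t4 : R) (x0 x1 x2 x3 x4 : R) :
  uniq [:: a; b; c; d] ->
  val eab = [set a; b]%SET -> val ecd = [set c; d]%SET ->
  val ebc = [set b; c]%SET -> val eda = [set d; a]%SET ->
  t1 \in L eab -> t2 \in L ecd -> t3 \in L ebc -> t4 \in L eda ->
  x0 <= t1 < x1 -> x1 <= t2 < x2 -> x2 <= t3 < x3 -> x3 <= t4 < x4 ->
  partial_spanner L [set a; b; c; d]%SET [set a; b; c; d]%SET x0 x4.
Proof.
move=> un eabE ecdE ebcE edaE l1 l2 l3 l4 h1 h2 h3 h4.
pose l := add_label (add_label (add_label (add_label (fun=> fset0)
  eab t1) ecd t2) ebc t3) eda t4.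
have cQ : #|[set a; b; c; d]%SET| = 4%N.
  rewrite -[4%N]/(size [:: a; b; c; d]) -(card_uniqP un).
  by apply: eq_card => z; rewrite !inE -!orbA.
exists l.
  rewrite cQ; apply: labels_in_addr h4 l4 => //.
  apply: labels_in_addr h3 l3 => //; apply: labels_in_addr h2 l2 => //.
  by apply: labels_in_addr h1 l1 => //; exact: labels_in0.
have sub e t l' e' : (l' e' `<=` add_label l' e t e')%fset by exact: add_label_sub.
have ab : ledge l a b t1.
  exists eab => //; do 3 apply: (fsubsetP (sub _ _ _ _)).
  by rewrite /add_label eqxx fset1U1.
have cd : ledge l c d t2.
  exists ecd => //; do 2 apply: (fsubsetP (sub _ _ _ _)).
  by rewrite /add_label eqxx fset1U1.
have bc : ledge l b c t3.
  exists ebc => //; do 1 apply: (fsubsetP (sub _ _ _ _)).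
  by rewrite /add_label eqxx fset1U1.
have da : ledge l d a t4 by exact: ledge_add_label.
case/andP: h1 => h1 h1'; case/andP: h2 => h2 h2'.
case/andP: h3 => h3 h3'; case/andP: h4 => h4 h4'.
have one u v t : ledge l u v t -> x0 <= t -> t <= x4 -> treach l x0 x4 u v.
  by move=> uv a1 a2; exact: (treach1 a1 a2 uv).
have two u v w s t : ledge l u v s -> ledge l v w t -> x0 <= s -> s <= t ->
    t <= x4 -> treach l x0 x4 u w.
  move=> uv vw a1 a2 a3; apply: (treach_step a1 (le_trans a2 a3) uv).
  exact: (treach1 a2 a3 vw).
have ba := ledge_sym ab; have dc := ledge_sym cd.
have cb := ledge_sym bc; have ad := ledge_sym da.
move=> u v; rewrite !inE -!orbA.
case/or4P => /eqP -> /or4P[] /eqP ->; try exact: treach_refl.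
- apply: (one _ _ _ ab); lra.
- apply: (two _ _ _ _ _ ab bc); lra.
- apply: (one _ _ _ ad); lra.
- apply: (one _ _ _ ba); lra.
- apply: (one _ _ _ bc); lra.
- apply: (two _ _ _ _ _ ba ad); lra.
- apply: (two _ _ _ _ _ cd da); lra.
- apply: (one _ _ _ cb); lra.
- apply: (one _ _ _ cd); lra.
- apply: (one _ _ _ da); lra.
- apply: (two _ _ _ _ _ dc cb); lra.
- apply: (one _ _ _ dc); lra.
Qed.

End PartialSpanners.

(** * Growing a vertex set cell by cell *)

Section Growth.
Context {R : realType} {V : finType}.
Implicit Types (L : vpair V -> {fset R}) (S A B : {set V}) (g : {set vpair V}).

Definition layer L (W : set R) : {set vpair V} :=
  [set e | [fset y in L e | y \in W]%fset != fset0]%SET.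

Lemma mem_layer L x y e : e \in layer L `[x, y[%classic ->
  exists2 t, t \in L e & x <= t < y.
Proof.
rewrite inE => /fset0Pn[t]; rewrite !inE /= => /andP[te /set_mem].
by rewrite /= in_itv /= => xty; exists t.
Qed.

Definition cut_vertex S g (v : V) : bool :=
  (v \notin S) && [exists u in S, exists e in g, val e == [set u; v]%SET].

(** At most one vertex joins per cell, so only one label of the cell is used and the order of labels
    inside a cell never matters. *)
Definition grow1 S g : {set V} :=
  if [pick v | cut_vertex S g v] is Some v then (v |: S)%SET else S.

Definition grow S (gs : seq {set vpair V}) : {set V} := foldl grow1 S gs.

Lemma sub_grow1 S g : S \subset grow1 S g.
Proof. by rewrite /grow1; case: pickP => [v _|_] //; exact: finset.subsetUr. Qed.

Definition out_cells (x delta : R) (i0 M : nat) : seq (set R) :=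
  [seq `[x + i%:R * delta, x + i.+1%:R * delta[%classic | i <- iota i0 M].

(** Listed backwards in time from [y], because gathering is broadcasting in reversed time. *)
Definition in_cells (y delta : R) (i0 M : nat) : seq (set R) :=
  [seq `[y - i.+1%:R * delta, y - i%:R * delta[%classic | i <- iota i0 M].

Lemma partial_spanner_grow_out L A B (lo x delta : R) i0 M : 0 <= delta ->
  (4 <= #|A| + #|B|)%N -> partial_spanner L A B lo (x + i0%:R * delta) ->
  partial_spanner L A (grow B (map (layer L) (out_cells x delta i0 M)))
    lo (x + (i0 + M)%:R * delta).
Proof.
move=> d0; elim: M i0 B => [|M IH] i0 B c4 ps; first by rewrite addn0.
rewrite /= addnS -addSn; apply: IH.
  by apply: leq_trans c4 _; rewrite leq_add2l subset_leq_card // sub_grow1.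
have ii : x + i0%:R * delta <= x + i0.+1%:R * delta.
  by rewrite lerD2l ler_wpM2r // ler_nat.
rewrite /grow1; case: pickP => [v|_]; last exact: partial_spanner_weaken ps.
case/andP => vB /existsP[u /andP[uB /existsP[e /andP[/mem_layer[t te xty] /eqP ee]]]].
exact: partial_spanner_out ps uB vB ee te (lexx _) xty.
Qed.

Lemma partial_spanner_grow_in L A B (hi y delta : R) i0 M : 0 <= delta ->
  (4 <= #|A| + #|B|)%N -> partial_spanner L A B (y - i0%:R * delta) hi ->
  partial_spanner L (grow A (map (layer L) (in_cells y delta i0 M))) B
    (y - (i0 + M)%:R * delta) hi.
Proof.
move=> d0; elim: M i0 A => [|M IH] i0 A c4 ps; first by rewrite addn0.
rewrite /= addnS -addSn; apply: IH.
  by apply: leq_trans c4 _; rewrite leq_add2r subset_leq_card // sub_grow1.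
have ii : y - i0.+1%:R * delta <= y - i0%:R * delta.
  by rewrite lerD2l lerN2 ler_wpM2r // ler_nat.
rewrite /grow1; case: pickP => [v|_]; last exact: partial_spanner_weaken ps.
case/andP => vA /existsP[u /andP[uA /existsP[e /andP[/mem_layer[t te xty] /eqP ee]]]].
exact: partial_spanner_in ps uA vA ee te (lexx _) xty.
Qed.

End Growth.

(** * Finite expectations over independent random edge sets *)

Section LayerExpectation.
Context {R : realType} {E : finType}.
Implicit Types (g : {set E}) (q : R) (qs : seq R) (F G : seq {set E} -> R).

(** The law of a random subset containing each element independently with probability [q]. *)
Definition layer_weight q g : R := \prod_e (if e \in g then q else 1 - q).

(** Expectation over independent layers, one per entry of [qs]. As an iterated finite sum it calls
    for no integration theory, and peeling off a layer is conditioning on it. *)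
Fixpoint expect qs F : R :=
  if qs is q :: qs' then
    \sum_g layer_weight q g * expect qs' (fun s => F (g :: s))
  else F [::].

Definition probs qs := all (fun q => 0 <= q <= 1) qs.

Lemma layer_weight_ge0 q g : 0 <= q <= 1 -> 0 <= layer_weight q g.
Proof.
by move=> /andP[q0 q1]; apply: prodr_ge0 => e _; case: ifP => _; rewrite ?subr_ge0.
Qed.

(** The sum is a product expanded by distributivity: setting [q] to 0 on [C] kills exactly the
    subsets that meet [C]. *)
Lemma sum_layer_weight_avoid q (C : {set E}) :
  \sum_(g : {set E} | [disjoint g & C]) layer_weight q g = (1 - q) ^+ #|C|.
Proof.
transitivity (\prod_e ((if e \in C then 0 else q) + (1 - q))).
  rewrite bigA_distr big_mkcond; apply: eq_bigr => g _; case: ifPn => dgC.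
    apply: eq_bigr => e _; case: ifPn => // eg.
    by rewrite (disjointFr dgC eg).
  move: dgC; rewrite disjoint_subset => /subsetPn[e eg]; rewrite inE negbK => eC.
  by rewrite (bigD1 e) //= eg eC mul0r.
rewrite (bigID (mem C)) /= [X in _ * X]big1 ?mulr1 => [|e /negPf ->]; last ring.
rewrite -prodr_const; apply: eq_bigr => e ->; by rewrite add0r.
Qed.

Lemma sum_layer_weight_contain q (C : {set E}) :
  \sum_(g : {set E} | C \subset g) layer_weight q g = q ^+ #|C|.
Proof.
transitivity (\prod_e (q + (if e \in C then 0 else 1 - q))).
  rewrite bigA_distr big_mkcond; apply: eq_bigr => g _; case: ifPn => Cg.
    apply: eq_bigr => e _; case: ifPn => // /negP eg; case: ifPn => // eC.
    by case: eg; exact: (fintype.subsetP Cg).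
  move: Cg => /subsetPn[e eC eg].
  by rewrite (bigD1 e) //= eC (negPf eg) mul0r.
rewrite (bigID (mem C)) /= [X in _ * X]big1 ?mulr1 => [|e /negPf ->]; last ring.
rewrite -prodr_const; apply: eq_bigr => e ->; by rewrite addr0.
Qed.

Lemma sum_layer_weight q : \sum_g layer_weight q g = 1.
Proof.
rewrite -(expr0 q) -(cards0 E) -sum_layer_weight_contain.
by apply: eq_bigl => g; rewrite finset.sub0set.
Qed.

Lemma eq_expect qs F G : (forall s, size s = size qs -> F s = G s) ->
  expect qs F = expect qs G.
Proof.
elim: qs F G => [|q qs IH] F G FG /=; first exact: FG.
apply: eq_bigr => g _; congr (_ * _); apply: IH => s ss.
by apply: FG; rewrite /= ss.
Qed.

Lemma le_expect qs F G : probs qs ->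
  (forall s, size s = size qs -> F s <= G s) -> expect qs F <= expect qs G.
Proof.
elim: qs F G => [|q qs IH] F G /=; first by move=> _; exact.
move=> /andP[q01 pqs] FG; apply: ler_sum => g _.
apply: ler_wpM2l; first exact: layer_weight_ge0.
by apply: IH => // s ss; apply: FG; rewrite /= ss.
Qed.

Lemma expectD qs F G :
  expect qs (fun s => F s + G s) = expect qs F + expect qs G.
Proof.
elim: qs F G => [//|q qs IH] F G /=.
by rewrite -big_split; apply: eq_bigr => g _; rewrite IH mulrDr.
Qed.

Lemma expectZ qs (a : R) F : expect qs (fun s => a * F s) = a * expect qs F.
Proof.
elim: qs F => [//|q qs IH] F /=.
by rewrite big_distrr; apply: eq_bigr => g _; rewrite /= IH mulrCA.
Qed.

Lemma expect_sum (I : Type) (r : seq I) qs (F : I -> seq {set E} -> R) :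
  expect qs (fun s => \sum_(i <- r) F i s) = \sum_(i <- r) expect qs (F i).
Proof.
elim: qs F => [//|q qs IH] F /=.
rewrite exchange_big; apply: eq_bigr => g _ /=.
by rewrite IH big_distrr.
Qed.

Lemma expect_cst qs (a : R) : expect qs (fun=> a) = a.
Proof.
elim: qs => [//|q qs IH] /=; rewrite IH -big_distrl /=.
by rewrite sum_layer_weight mul1r.
Qed.

Lemma expect_cat qs qs' F : expect (qs ++ qs') F =
  expect qs (fun s => expect qs' (fun s' => F (s ++ s'))).
Proof. by elim: qs F => [//|q qs IH] F /=; apply: eq_bigr => g _; rewrite IH. Qed.

End LayerExpectation.

(** * Drift of the growth chain and its probability of failure *)

Section GrowthProbability.
Context {R : realType} {V : finType}.
Implicit Types (S : {set V}) (g : {set vpair V}) (q : R).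

Definition cut_edges S : {set vpair V} :=
  [set e | [exists u in S, exists v in ~: S, val e == [set u; v]]]%SET.

(** The map from (u, v) to {u, v} is injective on the product of [S] and its complement, since the
    pair tells which end lies in [S]. *)
Lemma card_cut_edges S : (#|S| * (#|V| - #|S|) <= #|cut_edges S|)%N.
Proof.
have -> : (#|V| - #|S| = #|~: S|)%N by rewrite [RHS]cardsCs finset.setCK.
rewrite -(card_imset _ val_inj) -cardsX.
pose f (p : V * V) : {set V} := [set p.1; p.2]%SET.
rewrite -(card_in_imset (f := f)).
  apply/subset_leq_card/fintype.subsetP => z /imsetP[[u v]].
  rewrite inE /= => /andP[uS vS] ->{z}.
  have uv : u != v by apply: contraTneq vS => <-; rewrite inE uS.
  have c2 : #|[set u; v]%SET| == 2%N by rewrite cards2 uv.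
  apply/imsetP; exists (exist _ [set u; v]%SET c2) => //.
  rewrite inE; apply/existsP; exists u; rewrite uS /=.
  by apply/existsP; exists v; rewrite vS /=.
move=> [u v] [u' v'] /=; rewrite !inE /= => /andP[uS vS] /andP[uS' vS'].
move=> /setP e; have := e u; have := e v; rewrite /f /= !inE !eqxx /= orbT.
have -> : v == u' = false by apply: contraNF vS => /eqP ->.
have -> : u == v' = false by apply: contraNF vS' => /eqP <-.
by rewrite orbF /= => /esym/eqP -> /esym/eqP ->.
Qed.

Lemma cut_edgesP S g : reflect (exists v, cut_vertex S g v) (~~ [disjoint g & cut_edges S]).
Proof.
apply: (iffP idP).
  rewrite disjoint_subset => /subsetPn[e eg]; rewrite inE negbK inE.
  move=> /existsP[u /andP[uS /existsP[v /andP[vS ee]]]].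
  exists v; rewrite /cut_vertex -finset.in_setC vS /=.
  by apply/existsP; exists u; rewrite uS; apply/existsP; exists e; rewrite eg.
move=> [v /andP[vS /existsP[u /andP[uS /existsP[e /andP[eg ee]]]]]].
apply/pred0Pn; exists e; rewrite /= eg /= inE.
apply/existsP; exists u; rewrite uS; apply/existsP; exists v.
by rewrite finset.in_setC vS.
Qed.

(** The growth of the size depends on the layer only through the presence of a cut edge, whichever
    vertex is chosen. *)
Lemma card_grow1 S g : #|grow1 S g| = (#|S| + ~~ [disjoint g & cut_edges S])%N.
Proof.
rewrite /grow1; case: pickP => [v cv|cv].
  have /andP[vS _] := cv.
  by have /cut_edgesP -> : exists v, cut_vertex S g v by [exists v];
    rewrite cardsU1 vS addnC.
suff -> : [disjoint g & cut_edges S]%bool by rewrite addn0.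
by apply/negPn/negP => /cut_edgesP[v]; rewrite cv.
Qed.

(* In continuous time the growing set passes from size k to size k + 1 at rate
   k (n - k), and this function is an eigenfunction of the generator of that
   chain, with eigenvalue - (n - 1). *)
Definition potential (k : nat) : R := (#|V|%:R - k%:R) / (k%:R - 1).

Lemma potential_ge0 k : (2 <= k <= #|V|)%N -> 0 <= potential k.
Proof.
move=> /andP[k2 kn]; rewrite divr_ge0 ?subr_ge0 ?ler_nat //.
by rewrite (ler_nat R 1) ltnW.
Qed.

Lemma sub_potentialS k : (2 <= k)%N ->
  potential k - potential k.+1 = (#|V|%:R - 1) / (k%:R * (k%:R - 1)).
Proof.
move=> k2; rewrite /potential -natr1.
have : (2 : R) <= k%:R by rewrite ler_nat.
by move=> k2'; field; apply/andP; split; apply/eqP; lra.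
Qed.

(** The continuous decay (n - 1) delta over one cell, divided by a correction for using a cell at
    most once. *)
Definition growth_rate (delta : R) : R :=
  (#|V|%:R - 1) * delta / (1 + delta * #|V|%:R ^+ 2).

(** One cell contracts the expected potential by a factor independent of [S]; this is the
    eigenfunction property with an error absorbed in [growth_rate]. *)
Lemma expect_grow1 S (delta : R) : 0 <= delta -> (2 <= #|S|)%N ->
  \sum_g layer_weight (1 - expR (- delta)) g * potential #|grow1 S g| <=
  (1 - growth_rate delta) * potential #|S|.
Proof.
move=> d0 k2; set q := 1 - expR (- delta); set k := #|S|.
have kn : (k <= #|V|)%N by exact: max_card.
pose C := cut_edges S.
(* The potential takes the value for k + 1, plus the drop back to k when no cut edge is hit. *)
have -> : \sum_g layer_weight q g * potential #|grow1 S g| =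
    potential k.+1 + (1 - q) ^+ #|C| * (potential k - potential k.+1).
  under eq_bigr do rewrite card_grow1 -/k -/C.
  rewrite -(sum_layer_weight_avoid q C) mulr_suml.
  rewrite -[X in _ = X + _]mul1r -(sum_layer_weight (E := vpair V) q) mulr_suml.
  rewrite [X in _ = _ + X]big_mkcond -big_split; apply: eq_bigr => g _ /=.
  by case: ifP => _ /=; rewrite ?addn1 ?addn0; ring.
rewrite /q subKr -expRM_natl mulrN.
set n := #|V|%:R : R; pose x := k%:R : R.
have x2 : 2 <= x by rewrite ler_nat.
have xn : x <= n by rewrite ler_nat.
have cC : x * (n - x) <= #|C|%:R.
  by rewrite -natrB // -natrM ler_nat card_cut_edges.
have dp : potential k - potential k.+1 = (n - 1) / (x * (x - 1)).
  exact: sub_potentialS.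
have dp0 : 0 <= potential k - potential k.+1.
  by rewrite dp; apply: divr_ge0; nra.
set y := x * (n - x) * delta.
have y0 : 0 <= y by rewrite /y !mulr_ge0 ?subr_ge0 //; lra.
have yn : y <= delta * n ^+ 2.
  rewrite /y mulrC ler_wpM2l // expr2 ler_pM ?subr_ge0 //; lra.
(* Here exp(-y) <= 1/(1 + y) <= 1 - y/(1 + delta n^2), the last step because y <= delta n^2. *)
have e1 : expR (- (#|C|%:R * delta)) <= 1 - y / (1 + delta * n ^+ 2).
  apply: (@le_trans _ _ (1 + y)^-1).
    rewrite expRN lef_pV2 ?posrE ?expR_gt0 //; last lra.
    apply: le_trans (expR_ge1Dx _); rewrite lerD2l /y ler_wpM2r //.
  rewrite -subr_ge0.
  have -> : 1 - y / (1 + delta * n ^+ 2) - (1 + y)^-1 =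
     (delta * n ^+ 2 - y) * y / ((1 + delta * n ^+ 2) * (1 + y)).
    by field; apply/andP; split; apply/eqP; lra.
  apply: divr_ge0; first by rewrite mulr_ge0 ?subr_ge0.
  by rewrite mulr_ge0 //; lra.
(* The identity k (n - k) * (n - 1)/(k (k - 1)) = (n - 1) * [potential k] removes k from the
   rate. *)
have -> : (1 - growth_rate delta) * potential k =
    potential k.+1 + (1 - y / (1 + delta * n ^+ 2)) * (potential k - potential k.+1).
  rewrite mulrBl mul1r mulrBl mul1r addrA subrKC; congr (_ - _).
  rewrite dp /growth_rate /potential -/n -/x /y; field.
  by do ?[apply/andP; split]; apply/eqP; nra.
by rewrite lerD2l ler_wpM2r.
Qed.

(** Markov's inequality: while a vertex is missing the potential is at least 1/(n - 2), so n - 2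
    times the potential dominates the indicator of failure; each cell then contributes one
    contraction. *)
Lemma expect_grow_failure S (delta : R) (M : nat) : 0 <= delta ->
  (2 <= #|S|)%N -> 0 <= 1 - growth_rate delta ->
  expect (nseq M (1 - expR (- delta)))
    (fun s => (grow S s != [set: V]%SET)%:R) <=
  (#|V|%:R - 2) * (1 - growth_rate delta) ^+ M * potential #|S|.
Proof.
move=> d0 + r0; elim: M S => [|M IH] S S2 /=.
  have Sn : (#|S| <= #|V|)%N by exact: max_card.
  have n2 : 2 <= #|V|%:R :> R by rewrite ler_nat (leq_trans S2).
  rewrite expr0 mulr1; case: eqP => [_|/eqP ST] /=.
    by rewrite mulr_ge0 ?potential_ge0 ?S2 // subr_ge0.
  have : (#|S| < #|V|)%N by rewrite -cardsT proper_card // properT.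
  rewrite -(ler_nat R) -natr1 => SV.
  have S2' : 2 <= #|S|%:R :> R by rewrite ler_nat.
  by rewrite /potential mulrA ler_pdivlMr; nra.
apply: (@le_trans _ _ (\sum_g layer_weight (1 - expR (- delta)) g *
  ((#|V|%:R - 2) * (1 - growth_rate delta) ^+ M * potential #|grow1 S g|))).
  apply: ler_sum => g _; apply: ler_wpM2l.
    apply: layer_weight_ge0; rewrite subr_ge0 expR_le1 oppr_le0 d0 /=.
    by rewrite lerBlDr lerDl expR_ge0.
  by apply: IH; rewrite (leq_trans S2) // subset_leq_card // sub_grow1.
under eq_bigr do rewrite mulrCA.
rewrite -mulr_sumr exprSr -!mulrA; apply: ler_wpM2l.
  by rewrite subr_ge0 ler_nat (leq_trans S2) // max_card.
by apply: ler_wpM2l; [rewrite exprn_ge0|exact: expect_grow1].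
Qed.

End GrowthProbability.

(** * Existence of a 4-cycle by the second moment method *)

Section SecondMoment.
Context {R : realType} {E : finType}.
Implicit Types (g : {set E}) (q : R) (qs : seq R).

(** With m the mean of X, the indicator of X = 0 is at most (X/m - 1)^2; expanding the square gives
    the bound. *)
Lemma chebyshev_expect qs (X : seq {set E} -> R) : probs qs ->
  0 < expect qs X ->
  expect qs (fun s => (X s == 0)%:R) <=
  expect qs (fun s => X s * X s) / expect qs X ^+ 2 - 1.
Proof.
move=> pqs; set m := expect qs X => m0.
apply: (@le_trans _ _ (expect qs (fun s => m ^- 2 * (X s * X s) +
    ((- 2 / m) * X s + 1)))).
  apply: le_expect => // s _.
  have -> : m ^- 2 * (X s * X s) + (- 2 / m * X s + 1) = (X s / m - 1) ^+ 2.
    by field; exact: lt0r_neq0.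
  by case: eqP => [->|_]; rewrite ?mul0r ?sub0r ?sqrrN ?expr1n // sqr_ge0.
rewrite expectD expectD !expectZ expect_cst -/m le_eqVlt; apply/orP; left.
by apply/eqP; field; exact: lt0r_neq0.
Qed.

Lemma expect_cons q qs (f : {set E} -> R) (G : seq {set E} -> R) :
  expect (q :: qs) (fun s => f (head finset.set0 s) * G (behead s)) =
  (\sum_g layer_weight q g * f g) * expect qs G.
Proof.
rewrite /= mulr_suml; apply: eq_bigr => g _; rewrite -mulrA; congr (_ * _).
exact: expectZ.
Qed.

Lemma expect4 q (f1 f2 f3 f4 : {set E} -> R) :
  expect (nseq 4 q) (fun s => let g := nth finset.set0 s in
    f1 (g 0%N) * (f2 (g 1%N) * (f3 (g 2%N) * f4 (g 3%N)))) =
  (\sum_g layer_weight q g * f1 g) * ((\sum_g layer_weight q g * f2 g) *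
  ((\sum_g layer_weight q g * f3 g) * (\sum_g layer_weight q g * f4 g))).
Proof.
pose hd := head (@finset.set0 E).
(* The factor 1 brings the last layer into the shape of [expect_cons]. *)
pose F4 (s : seq {set E}) : R := f4 (hd s) * 1.
pose F3 (s : seq {set E}) := f3 (hd s) * F4 (behead s).
pose F2 (s : seq {set E}) := f2 (hd s) * F3 (behead s).
rewrite (eq_expect (G := fun s => f1 (hd s) * F2 (behead s))); last first.
  by move=> [//|g1 [//|g2 [//|g3 [//|g4 [|//]]]]] _; rewrite /F2 /F3 /F4 /= mulr1.
rewrite (expect_cons q (nseq 3 q) f1 F2) (expect_cons q (nseq 2 q) f2 F3).
rewrite (expect_cons q (nseq 1 q) f3 F4) (expect_cons q [::] f4 (fun=> 1)).
by rewrite mulr1.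
Qed.

Let natr_andb (b c : bool) : (b && c)%:R = b%:R * c%:R :> R.
Proof. by rewrite -mulnb natrM. Qed.

Lemma sum_layer_weight_mem q (e : E) :
  \sum_g layer_weight q g * (e \in g)%:R = q.
Proof.
rewrite -[RHS]expr1 -(cards1 e) -sum_layer_weight_contain [RHS]big_mkcond /=.
by apply: eq_bigr => g _; rewrite finset.sub1set; case: ifP; rewrite ?mulr1 ?mulr0.
Qed.

Lemma sum_layer_weight_mem2 q (e e' : E) :
  \sum_g layer_weight q g * ((e \in g)%:R * (e' \in g)%:R) =
  if e == e' then q else q ^+ 2.
Proof.
transitivity (q ^+ #|[set e; e']%SET|).
  rewrite -sum_layer_weight_contain [RHS]big_mkcond /=.
  apply: eq_bigr => g _; rewrite finset.subUset !finset.sub1set.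
  by case: (e \in g); case: (e' \in g); rewrite ?mulr1 ?mulr0.
by rewrite cards2; case: eqP.
Qed.

Context (N : nat) (e1 e2 e3 e4 : 'I_N -> 'I_N -> E).
Hypothesis inj1 : forall a b a' b', e1 a b = e1 a' b' -> a = a' /\ b = b'.
Hypothesis inj2 : forall a b a' b', e2 a b = e2 a' b' -> a = a' /\ b = b'.
Hypothesis inj3 : forall a b a' b', e3 a b = e3 a' b' -> a = a' /\ b = b'.
Hypothesis inj4 : forall a b a' b', e4 a b = e4 a' b' -> a = a' /\ b = b'.

Let I4 : finType := ('I_N * 'I_N * ('I_N * 'I_N))%type.
Implicit Types i j : I4.

(** With [i] read as ((a, b), (c, d)), the four layers must contain ab, cd, bc, da in this order. *)
Definition is_cycle (s : seq {set E}) i : bool :=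
  let g := nth finset.set0 s in
  [&& e1 i.1.1 i.1.2 \in g 0%N, e2 i.2.1 i.2.2 \in g 1%N,
      e3 i.1.2 i.2.1 \in g 2%N & e4 i.2.2 i.1.1 \in g 3%N].

Definition num_cycles s : R := \sum_i (is_cycle s i)%:R.

Lemma expect_num_cycles q : expect (nseq 4 q) num_cycles = N%:R ^+ 4 * q ^+ 4.
Proof.
rewrite expect_sum.
have H i : expect (nseq 4 q) (fun s => (is_cycle s i)%:R) = q ^+ 4.
  rewrite (eq_expect (G := fun s => let g := nth finset.set0 s in
    (e1 i.1.1 i.1.2 \in g 0%N)%:R * ((e2 i.2.1 i.2.2 \in g 1%N)%:R *
    ((e3 i.1.2 i.2.1 \in g 2%N)%:R * (e4 i.2.2 i.1.1 \in g 3%N)%:R)))); last first.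
    by move=> s _; rewrite /is_cycle !natr_andb.
  rewrite (expect4 q (fun g => (_ \in g)%:R) (fun g => (_ \in g)%:R)
    (fun g => (_ \in g)%:R) (fun g => (_ \in g)%:R)).
  by rewrite !sum_layer_weight_mem; ring.
rewrite (eq_bigr (fun=> q ^+ 4)) => [|i _]; last exact: H.
rewrite sumr_const !card_prod card_ord -[LHS]mulr_natl -natrX.
by congr (_%:R * _); rewrite !expnS expn0 muln1 !mulnA.
Qed.

(** A flag that is true forces agreement with [i] in its coordinate; each of the others leaves [N]
    free choices. *)
Lemma sum_agree i (b1 b2 b3 b4 : bool) :
  \sum_j ((b1 ==> (i.1.1 == j.1.1)) && (b2 ==> (i.1.2 == j.1.2)) &&
    ((b3 ==> (i.2.1 == j.2.1)) && (b4 ==> (i.2.2 == j.2.2))))%:R =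
  N%:R ^+ (~~ b1 + ~~ b2 + (~~ b3 + ~~ b4)) :> R.
Proof.
have one (b : bool) (x : 'I_N) : \sum_y (b ==> (x == y))%:R = N%:R ^+ (~~ b) :> R.
  case: b => /=; last by rewrite sumr_const card_ord.
  rewrite (bigD1 x) //= eqxx big1 ?addr0 // => y /negPf.
  by rewrite eq_sym => ->.
have two (b b' : bool) (x : 'I_N * 'I_N) :
    \sum_y ((b ==> (x.1 == y.1)) && (b' ==> (x.2 == y.2)))%:R =
    N%:R ^+ (~~ b + ~~ b') :> R.
  rewrite exprD -(one _ x.1) -(one _ x.2) big_distrlr pair_bigA.
  by apply: eq_bigr => y _; exact: natr_andb.
rewrite exprD -(two _ _ i.1) -(two _ _ i.2) big_distrlr pair_bigA.
by apply: eq_bigr => j _; exact: natr_andb.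
Qed.

(** Pairs of cycles are sorted by the vertices they share. One common edge fixes two vertices; two
    adjacent common edges fix three; two opposite ones fix all four, and then all four edges
    agree. *)
Lemma expect_sqr_num_cycles q : 0 < q -> expect (nseq 4 q)
    (fun s => num_cycles s * num_cycles s) <=
  N%:R ^+ 4 * (q ^+ 8 * N%:R ^+ 4 + 4 * q ^+ 7 * N%:R ^+ 2 +
    4 * q ^+ 6 * N%:R + q ^+ 4).
Proof.
move=> q0.
(* The probability that one layer contains both edges, depending on whether they coincide. *)
pose w (b : bool) : R := if b then q else q ^+ 2.
have H i j : expect (nseq 4 q) (fun s => (is_cycle s i)%:R * (is_cycle s j)%:R) =
    w (e1 i.1.1 i.1.2 == e1 j.1.1 j.1.2) * (w (e2 i.2.1 i.2.2 == e2 j.2.1 j.2.2) *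
    (w (e3 i.1.2 i.2.1 == e3 j.1.2 j.2.1) * w (e4 i.2.2 i.1.1 == e4 j.2.2 j.1.1))).
  pose f (e e' : E) g : R := (e \in g)%:R * (e' \in g)%:R.
  rewrite (eq_expect (G := fun s => let g := nth finset.set0 s in
    f (e1 i.1.1 i.1.2) (e1 j.1.1 j.1.2) (g 0%N) *
    (f (e2 i.2.1 i.2.2) (e2 j.2.1 j.2.2) (g 1%N) *
    (f (e3 i.1.2 i.2.1) (e3 j.1.2 j.2.1) (g 2%N) *
     f (e4 i.2.2 i.1.1) (e4 j.2.2 j.1.1) (g 3%N))))); last first.
    by move=> s _; rewrite /is_cycle /f !natr_andb; ring.
  by rewrite expect4 !sum_layer_weight_mem2.
pose ag (b1 b2 b3 b4 : bool) i j : R :=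
  ((b1 ==> (i.1.1 == j.1.1)) && (b2 ==> (i.1.2 == j.1.2)) &&
    ((b3 ==> (i.2.1 == j.2.1)) && (b4 ==> (i.2.2 == j.2.2))))%:R.
pose T := true; pose F := false.
(* Each sharing pattern contributes its own term; a pair may be counted in several, which is
   harmless for an upper bound. *)
pose bnd i j : R := q ^+ 8 * ag F F F F i j
  + q ^+ 7 * (ag T T F F i j + ag F F T T i j + ag F T T F i j + ag T F F T i j)
  + q ^+ 6 * (ag T T T F i j + ag F T T T i j + ag T F T T i j + ag T T F T i j)
  + q ^+ 4 * ag T T T T i j.
have Hb i j : expect (nseq 4 q) (fun s => (is_cycle s i)%:R * (is_cycle s j)%:R)
    <= bnd i j.
  rewrite H.
  have -> : (e1 i.1.1 i.1.2 == e1 j.1.1 j.1.2) = (i.1.1 == j.1.1) && (i.1.2 == j.1.2).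
    by apply/eqP/andP => [/inj1[-> ->]|[/eqP -> /eqP ->]].
  have -> : (e2 i.2.1 i.2.2 == e2 j.2.1 j.2.2) = (i.2.1 == j.2.1) && (i.2.2 == j.2.2).
    by apply/eqP/andP => [/inj2[-> ->]|[/eqP -> /eqP ->]].
  have -> : (e3 i.1.2 i.2.1 == e3 j.1.2 j.2.1) = (i.1.2 == j.1.2) && (i.2.1 == j.2.1).
    by apply/eqP/andP => [/inj3[-> ->]|[/eqP -> /eqP ->]].
  have -> : (e4 i.2.2 i.1.1 == e4 j.2.2 j.1.1) = (i.2.2 == j.2.2) && (i.1.1 == j.1.1).
    by apply/eqP/andP => [/inj4[-> ->]|[/eqP -> /eqP ->]].
  have qX k : 0 <= q ^+ k by rewrite exprn_ge0 // ltW.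
  have := qX 4; have := qX 5; have := qX 6; have := qX 7; have := qX 8.
  rewrite /bnd /ag /w.
  case: (i.1.1 == j.1.1); case: (i.1.2 == j.1.2); case: (i.2.1 == j.2.1);
    case: (i.2.2 == j.2.2) => /= *; lra.
rewrite (eq_expect (G := fun s => \sum_i \sum_j (is_cycle s i)%:R * (is_cycle s j)%:R)); last first.
  by move=> s _; rewrite /num_cycles big_distrlr.
rewrite expect_sum; under eq_bigr do rewrite expect_sum.
apply: (@le_trans _ _ (\sum_i \sum_j bnd i j)).
  by apply: ler_sum => i _; apply: ler_sum => j _; exact: Hb.
rewrite (eq_bigr (fun=> q ^+ 8 * N%:R ^+ 4 + 4 * q ^+ 7 * N%:R ^+ 2 +
    4 * q ^+ 6 * N%:R + q ^+ 4)).
  rewrite sumr_const !card_prod card_ord -[X in X <= _]mulr_natl -natrX.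
  by rewrite !expnS expn0 muln1 !mulnA.
move=> i _; rewrite /bnd !big_split /= -!mulr_sumr !big_split /= /ag !sum_agree /=.
by rewrite /T /F /= !addn0 !addn1 !expr0 !expr1; ring.
Qed.

(** With z = N q, the relative variance is at most (4 z^6 q + 4 z^5 q + z^4)/z^8, and q <= 1 <= z
    bounds this by 9/z. *)
Lemma no_cycle_le q : q <= 1 -> 1 <= N%:R * q ->
  expect (nseq 4 q) (fun s => (~~ [exists i, is_cycle s i])%:R) <=
  9 / (N%:R * q).
Proof.
move=> q1 Nq1.
have N0 : 0 <= N%:R :> R by [].
have q0 : 0 < q by rewrite ltNge; apply/negP => q0; nra.
have N1 : 1 <= N%:R :> R by nra.
apply: (@le_trans _ _ (expect (nseq 4 q) (fun s => (num_cycles s == 0)%:R))).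
  apply: le_expect => [|s _].
    by apply/allP => x; rewrite mem_nseq => /eqP ->; rewrite ltW.
  rewrite ler_nat; case: existsP => // nE /=; rewrite [_ == _](_ : _ = true) //.
  apply/eqP; apply: big1 => i _; case: (boolP (is_cycle s i)) => // ci.
  by case: nE; exists i.
set z := N%:R * q in Nq1 *.
have mE : expect (nseq 4 q) num_cycles = z ^+ 4.
  by rewrite expect_num_cycles /z exprMn.
have z0 : 0 < z by lra.
apply: le_trans (chebyshev_expect _ _) _.
- by apply/allP => x; rewrite mem_nseq => /eqP ->; rewrite ltW.
- by rewrite mE exprn_gt0.
rewrite mE lerBlDr -exprM ler_pdivrMr ?exprn_gt0 //.
apply: le_trans (expect_sqr_num_cycles q0) _.
have -> : (9 / z + 1) * z ^+ 8 = 9 * z ^+ 7 + z ^+ 8.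
  by field; exact: lt0r_neq0.
have zX k : 1 <= z ^+ k by exact: exprn_ege1.
have -> : N%:R ^+ 4 * (q ^+ 8 * N%:R ^+ 4 + 4 * q ^+ 7 * N%:R ^+ 2 +
   4 * q ^+ 6 * N%:R + q ^+ 4) =
   z ^+ 8 + 4 * (z ^+ 6 * q) + 4 * (z ^+ 5 * q) + z ^+ 4 by rewrite /z; ring.
have h6 : z ^+ 6 * q <= z ^+ 7.
  rewrite -[leRHS]mulr1 ler_pM ?exprn_ge0 ?(ltW z0) ?(ltW q0) //.
  by rewrite ler_weXn2l.
have h5 : z ^+ 5 * q <= z ^+ 7.
  rewrite -[leRHS]mulr1 ler_pM ?exprn_ge0 ?(ltW z0) ?(ltW q0) //.
  by rewrite ler_weXn2l.
have h4 : z ^+ 4 <= z ^+ 7 by rewrite ler_weXn2l.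
lra.
Qed.

End SecondMoment.

(** * Iterated expectations as sums over outcomes *)

Section LayerLaw.
Context {R : realType} {E : finType}.

Lemma sum_tuple_cons (A : finType) (m : nat) (F : seq A -> R) :
  \sum_(t : m.+1.-tuple A) F t = \sum_a \sum_(t : m.-tuple A) F (a :: t).
Proof.
rewrite pair_bigA /= (reindex (fun p : A * m.-tuple A => cons_tuple p.1 p.2)) //.
exists (fun t => (thead t, behead_tuple t)) => [[a t] _|t _] /=.
  by congr pair; apply: val_inj.
by rewrite [RHS]tuple_eta; apply: val_inj.
Qed.

Lemma expect_tupleE (qs : seq R) (F : seq {set E} -> R) :
  expect qs F = \sum_(t : (size qs).-tuple {set E})
    (\prod_(i < size qs) layer_weight (nth 0 qs i) (nth finset.set0 t i)) * F t.
Proof.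
elim: qs F => [|q qs IH] F /=.
  rewrite (bigD1 [tuple]) //= big_ord0 mul1r big1 ?addr0 // => t /eqP[].
  exact: tuple0.
rewrite (sum_tuple_cons _ (fun t => (\prod_(i < (size qs).+1)
  layer_weight (nth 0 (q :: qs) i) (nth finset.set0 t i)) * F t)).
apply: eq_bigr => g _; rewrite IH big_distrr; apply: eq_bigr => t _ /=.
by rewrite big_ord_recl /= mulrA.
Qed.

End LayerLaw.

(* Indices beyond the end of the list are harmless, as [nth set0] gives the
   empty window there. *)
Definition windows (R : realType) (Ws : seq (set R)) (D : set R) : Prop :=
  [/\ forall i, measurable (nth set0 Ws i), forall i, nth set0 Ws i `<=` D &
      forall i j, (i < j)%N -> nth set0 Ws i `&` nth set0 Ws j = set0].

(** * The joint law of the layers of a Poisson labelling *)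

Section PoissonLayers.
Context {R : realType} (d : measure_display) (T : measurableType d)
  (P : probability T R) (n : nat) (p : R).
Context (L : T -> vpair 'I_n -> {fset R}).
Hypothesis hL : random_labels_H P p L.

Definition hit_prob (W : set R) : R := 1 - expR (- fine (lebesgue_measure W)).

Lemma poisson_prob0 (r : R) k : 0 <= r -> poisson_prob r k [set 0%N] = (expR (- r))%:E.
Proof.
rewrite /poisson_prob; case: ifPn => r0.
  rewrite esum_set1 ?lee_fin ?poisson_pmf_ge0 // /poisson_pmf r0.
  by rewrite expr0 fact0 invr1 !mul1r.
(* At rate 0 the Poisson law is defined as the Dirac mass at 0, in agreement with exp(0) = 1. *)
move=> r0'; have -> : r = 0 by apply/eqP; rewrite eq_le r0' leNgt r0.
by rewrite diracE mem_set //= oppr0 expR0.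
Qed.

Lemma npoints_eq0 e (W : set R) x :
  (npoints (L^~ e) W x == 0%N) = (e \notin layer (L x) W).
Proof. by rewrite /npoints inE negbK cardfs_eq0. Qed.

Definition hit_set (b : bool) : set nat := if b then ~` [set 0%N] else [set 0%N].

Lemma hit_setP e (W : set R) b x :
  hit_set b (npoints (L^~ e) W x) <-> (e \in layer (L x) W) = b.
Proof.
rewrite /hit_set; have := npoints_eq0 e W x.
case: b; case: (e \in layer (L x) W) => /= /eqP h; split => //.
Qed.

Lemma measurable_hit e (W : set R) (K : set nat) : measurable W ->
  W `<=` `[0, p] -> measurable (npoints (L^~ e) W @^-1` K).
Proof.
move=> mW Wp; have [_ mX _ _] := hL.1 e.
by rewrite -[X in measurable X]setTI; exact: mX.
Qed.

Lemma prob_hit e (W : set R) b : measurable W -> W `<=` `[0, p] ->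
  P (npoints (L^~ e) W @^-1` hit_set b) =
  (if b then hit_prob W else 1 - hit_prob W)%:E.
Proof.
move=> mW Wp; have [_ mX PX _] := hL.1 e.
have P0 : P (npoints (L^~ e) W @^-1` [set 0%N]) =
    (expR (- fine (lebesgue_measure W)))%:E.
  by rewrite PX // mul1r poisson_prob0 // fine_ge0.
case: b => /=; last by rewrite P0 /hit_prob subKr.
rewrite -preimage_setC probability_setC; first by rewrite P0.
exact: measurable_hit.
Qed.

(** Independence enters twice: between the pairs of vertices, and between disjoint windows of one
    pair. *)
Lemma prob_layers_eq (Ws : seq (set R)) (s : seq {set vpair 'I_n}) :
  windows Ws `[0, p] -> size s = size Ws ->
  P [set x | map (layer (L x)) Ws = s] =
  (\prod_(i < size Ws) layer_weight (hit_prob (nth set0 Ws i))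
     (nth finset.set0 s i))%:E.
Proof.
move=> [mW Wp tW] ss.
(* The event that the pair [e] shows the prescribed pattern in all windows. *)
pose A e := \bigcap_(i in [set` [set: 'I_(size Ws)]%SET])
  (npoints (L^~ e) (nth set0 Ws i) @^-1` hit_set (e \in nth finset.set0 s i)).
have -> : [set x | map (layer (L x)) Ws = s] =
    \bigcap_(e in [set` [set: vpair 'I_n]%SET]) A e.
  apply/seteqP; split => [x /= xs e _ i _|x /= xA].
    apply/hit_setP; rewrite -xs (nth_map set0) //.
  apply: (@eq_from_nth _ finset.set0); rewrite size_map // => i iW.
  rewrite (nth_map set0) //; apply/setP => e.
  have eT : e \in [set: vpair 'I_n]%SET by rewrite finset.in_setT.
  have iT : Ordinal iW \in [set: 'I_(size Ws)]%SET by rewrite finset.in_setT.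
  by have /hit_setP := xA e eT (Ordinal iW) iT.
have PA e : P (A e) = (\prod_(i < size Ws) (if e \in nth finset.set0 s i
    then hit_prob (nth set0 Ws i) else 1 - hit_prob (nth set0 Ws i)))%:E.
  have [_ _ _ ind] := hL.1 e.
  have tW' : trivIset setT (fun i : 'I_(size Ws) => nth set0 Ws i).
    move=> i j _ _ Wij; apply: val_inj; case: (ltngtP i j) => // ij.
      by move: Wij; rewrite tW // => -[].
    by move: Wij; rewrite setIC tW // => -[].
  rewrite /A (ind _ _ (fun i => mW i) (fun i => Wp i) tW') => [|i _]; last by exists (hit_set (e \in nth finset.set0 s i)).
  rewrite -prodEFin; apply: eq_big => [i|i _]; first by rewrite finset.in_setT.
  exact: prob_hit.
rewrite hL.2 => [|e _].
  rewrite exchange_big /= -prodEFin; apply: eq_big => [e|e _]; first by rewrite finset.in_setT.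
  by rewrite PA.
(* Independence of the pairs applies because [A e] is a finite intersection of generators of the
   sigma-algebra of [e]. *)
rewrite /process_sigma_algebra; set G := (X in <<s X >>).
suff : @measurable _ (g_sigma_algebraType G) (A e) by [].
apply: fin_bigcap_measurable; first exact: finite_finset.
move=> i _; apply: sub_sigma_algebra; exists (nth set0 Ws i) => //.
by exists (hit_set (e \in nth finset.set0 s i)).
Qed.

Lemma measurable_layers (Ws : seq (set R)) (s : seq {set vpair 'I_n}) :
  windows Ws `[0, p] -> size s = size Ws ->
  measurable [set x | map (layer (L x)) Ws = s].
Proof.
move=> [mW Wp tW] ss.
have -> : [set x | map (layer (L x)) Ws = s] =
    \bigcap_(ei in [set: vpair 'I_n * 'I_(size Ws)])
    (npoints (L^~ ei.1) (nth set0 Ws ei.2) @^-1` hit_set (ei.1 \in nth finset.set0 s ei.2)).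
  apply/seteqP; split => [x /= xs [e i] _|x /= xA].
    by apply/hit_setP; rewrite -xs (nth_map set0).
  apply: (@eq_from_nth _ finset.set0); rewrite size_map // => i iW.
  rewrite (nth_map set0) //; apply/setP => e.
  by have /hit_setP := xA (e, Ordinal iW) I.
apply: fin_bigcap_measurable => [|[e i] _]; first exact: finite_finset.
exact: measurable_hit.
Qed.

(** The bridge from the probability space to finite sums: any event about the layers splits into
    finitely many outcomes of known probability. *)
Lemma prob_layers (Ws : seq (set R)) (Q : pred (seq {set vpair 'I_n})) :
  windows Ws `[0, p] ->
  measurable [set x | Q (map (layer (L x)) Ws)] /\
  P [set x | Q (map (layer (L x)) Ws)] =
  (expect (map hit_prob Ws) (fun s => (Q s)%:R))%:E.
Proof.
move=> hW; pose m := size Ws.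
pose r := [seq t <- index_enum (m.-tuple {set vpair 'I_n}) | Q (val t)].
pose F (t : m.-tuple {set vpair 'I_n}) := [set x | map (layer (L x)) Ws = val t].
have mF t : measurable (F t) by apply: measurable_layers; rewrite ?size_tuple.
have -> : [set x | Q (map (layer (L x)) Ws)] = \bigcup_(t in [set` r]) F t.
  apply/seteqP; split => [x /= Qx|x [t /=]]; last first.
    by rewrite mem_filter => /andP[Qt _]; rewrite /F /= => ->.
  have sz : size (map (layer (L x)) Ws) == m by rewrite size_map.
  by exists (Tuple sz) => //=; rewrite mem_filter /= Qx mem_index_enum.
split; first by apply: fin_bigcup_measurable => //; exact: finite_seq.
have tF : trivIset [set` r] F.
  by move=> t t' _ _ [x []]; rewrite /F /= => -> /val_inj.
rewrite (measure_fin_bigcup _ (finite_seq r) tF) //.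
rewrite -fsbig_seq ?filter_uniq ?index_enum_uniq // big_filter.
rewrite expect_tupleE size_map -/m -sumEFin [LHS]big_mkcond.
apply: eq_bigr => t _; case: ifP => Qt; last by rewrite mulr0.
rewrite mulr1; etransitivity; first exact: (prob_layers_eq hW (size_tuple t)).
congr (_%:E).
by apply: eq_bigr => i _; rewrite (nth_map set0).
Qed.

End PoissonLayers.

(** * Invariance under monotone relabelling, and rounding to a grid *)

Section Discretization.
Context {R : realType} {V : finType}.
Implicit Types (l : vpair V -> {fset R}).

(** Weak monotonicity of [f] keeps the labels along paths sorted, and injectivity on each edge keeps
    the number of labels. *)
Lemma has_optimal_spanner_transport l l' (f : R -> R) :
  (forall e t, t \in l e -> f t \in l' e) ->
  (forall e e' s t, s \in l e -> t \in l e' -> s <= t -> f s <= f t) ->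
  (forall e s t, s \in l e -> t \in l e -> f s = f t -> s = t) ->
  has_optimal_spanner (tgraph_of_labels l) ->
  has_optimal_spanner (tgraph_of_labels l').
Proof.
move=> ff hle hinj [S [[[sE sL] con] num]].
have sub e t : e \in tedges S -> t \in tlabel S e -> t \in l e.
  by move=> eS; exact: (fsubsetP (sL e eS)).
exists (TGraph (tedges S) (fun e => [fset f t | t in tlabel S e]%fset)).
split; first split; first split.
- apply/fintype.subsetP => e /(fintype.subsetP sE); rewrite !inE.
  by move=> /fset0Pn[t te]; apply/fset0Pn; exists (f t); exact: ff.
- move=> e eS /=; apply/fsubsetP => _ /imfsetP[t /= tS ->].
  by apply: ff; exact: sub tS.
- move=> u v uv; have [ws [ts [sz un la so ed]]] := con u v uv.
  exists ws, (map f ts); split => //; first by rewrite size_map.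
  + have inl t : t \in ts -> exists e, t \in l e.
      move=> /(nthP 0)[i it <-]; rewrite sz in it.
      by have [e eS [_ te]] := ed i it; exists e; exact: sub te.
    rewrite sorted_map; apply: (sub_in_sorted _ (allss ts) so).
    move=> s t /inl[e se] /inl[e' te'] st; exact: hle se te' st.
  + move=> i iw; have [e eS [ee te]] := ed i iw; exists e => //; split => //.
    rewrite (nth_map 0) ?sz //; exact: in_imfset.
- rewrite -num; apply: eq_bigr => e eS /=; rewrite card_in_imfset //=.
  by move=> s t /= /(sub e s eS) se /(sub e t eS) te; exact: hinj se te.
Qed.

Lemma seq_pos_lower_bound (r : seq R) :
  exists2 a : R, 0 < a & forall x, x \in r -> 0 < x -> a <= x.
Proof.
elim: r => [|y r [a a0 ar]]; first by exists 1.
have [y0|y0] := ltP 0 y.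
  exists (Num.min a y); first by rewrite lt_min a0.
  move=> x; rewrite inE => /orP[/eqP ->|xr] x0; rewrite ge_min.
    by rewrite lexx orbT.
  by rewrite ar.
exists a => // x; rewrite inE => /orP[/eqP ->|]; last exact: ar.
by rewrite ltNge y0.
Qed.

(** The index of the grid cell rather than the rounded time, as only the order of the labels
    matters. *)
Definition grid (N : nat) (t : R) : R := (Num.floor (t * N.+1%:R))%:~R.

Lemma grid_le N : {homo grid N : s t / s <= t}.
Proof.
by move=> s t st; rewrite /grid ler_int; apply: le_floor; rewrite ler_wpM2r.
Qed.

(** Finitely many labels have a least positive gap, and a mesh at most that gap puts distinct labels
    into distinct cells. *)
Lemma grid_separates l : exists N0, forall N, (N0 <= N)%N ->
  forall e e' s t, s \in l e -> t \in l e' -> grid N s = grid N t -> s = t.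
Proof.
pose U := flatten [seq (l e : seq R) | e <- enum {: vpair V}].
have lU e t : t \in l e -> t \in U.
  by move=> te; apply/flattenP; exists (l e : seq R) => //; apply/map_f/mem_enum.
have [a a0 aU] := seq_pos_lower_bound [seq t - s | t <- U, s <- U].
exists (Num.bound a^-1) => N NN.
have aN : 1 <= a * N.+1%:R.
  rewrite mulrC -ler_pdivrMr // div1r.
  apply: (le_trans (ltW (archi_boundP _))); first by rewrite invr_ge0 ltW.
  by rewrite ler_nat leqW.
suff H s t : s \in U -> t \in U -> s < t -> grid N s != grid N t.
  move=> e e' s t /lU sU /lU tU g; apply/eqP; rewrite eq_le !leNgt.
  by apply/andP; split; apply/negP => /H => /(_ _ _)/eqP; apply.
move=> sU tU st; apply/negP => /eqP /intr_inj g.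
have := floor_le (s * N.+1%:R); have := floorD1_gt (t * N.+1%:R).
rewrite -g intrD.
have : a <= t - s by apply: aU; rewrite ?subr_gt0 //; exact: allpairs_f.
move=> ats h1 h2.
have : a * N.+1%:R <= (t - s) * N.+1%:R by rewrite ler_wpM2r.
by rewrite mulrBl; lra.
Qed.

Definition grid_labels N l : vpair V -> {fset R} :=
  fun e => [fset grid N t | t in l e]%fset.

(** On a fine enough grid, rounding is an order isomorphism on the labels, so spanners can be
    carried both ways. *)
Lemma has_optimal_spanner_grid l :
  has_optimal_spanner (tgraph_of_labels l) <->
  exists N0, forall N, (N0 <= N)%N ->
    has_optimal_spanner (tgraph_of_labels (grid_labels N l)).
Proof.
have [N1 HN1] := grid_separates l.
split => [opt|[N0 HN0]].
  exists N1 => N NN; apply: (@has_optimal_spanner_transport l _ (grid N)) opt.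
  - by move=> e t te; exact: in_imfset.
  - by move=> e e' s t _ _; exact: grid_le.
  - by move=> e s t; exact: HN1.
pose N := maxn N0 N1.
have NN : (N1 <= N)%N by exact: leq_maxr.
(* The inverse of rounding; the default 0 is only taken off the rounded labels. *)
pose inv r := xget 0 [set t | (exists e, t \in l e) /\ grid N t = r].
have invK e t : t \in l e -> inv (grid N t) = t.
  move=> te; rewrite /inv; case: xgetP => [s _ [[e' se'] g]|/(_ t) []].
    exact: HN1 se' te g.
  by split => //; exists e.
apply: (@has_optimal_spanner_transport _ l inv) (HN0 N (leq_maxl _ _)).
- by move=> e _ /imfsetP[t /= te ->]; rewrite (invK _ _ te).
- move=> e e' _ _ /imfsetP[s /= se ->] /imfsetP[t /= te ->].
  rewrite (invK _ _ se) (invK _ _ te) => st; rewrite leNgt; apply/negP => ts.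
  move: (ts); have /eqP : grid N s = grid N t.
    by apply/eqP; rewrite eq_le st grid_le // ltW.
  by move=> /eqP /(HN1 _ NN _ _ _ _ se te) ->; rewrite ltxx.
- move=> e _ _ /imfsetP[s /= se ->] /imfsetP[t /= te ->].
  by rewrite (invK _ _ se) (invK _ _ te) => ->.
Qed.

End Discretization.

(** * Measurability of the event *)

Section SpannerMeasurable.
Context {R : realType} (d : measure_display) (T : measurableType d)
  (P : probability T R) (n : nat) (p : R).
Context (L : T -> vpair 'I_n -> {fset R}).
Hypothesis hL : random_labels_H P p L.

(** Integer codes form a countable type, so an event determined by the code is a countable union. *)
Definition grid_code (N : nat) (x : T) : {ffun vpair 'I_n -> {fset int}} :=
  [ffun e => [fset Num.floor (t * N.+1%:R) | t in L x e]%fset].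

Lemma measurable_grid_code N c : measurable [set x | grid_code N x = c].
Proof.
(* Clipped to [0, p], where the counts are controlled and where all labels lie. *)
pose W (i : int) : set R :=
  `[0, p] `&` `[i%:~R / N.+1%:R, (i + 1)%:~R / N.+1%:R[.
have codeP x e i : (i \in grid_code N x e) = (e \in layer (L x) (W i)).
  rewrite ffunE inE; have N0 : 0 < N.+1%:R :> R by [].
  apply/imfsetP/fset0Pn => [[t /= te ->]|[t]].
    have [Lp _ _ _] := hL.1 e; have tp := Lp _ _ te.
    exists t; rewrite !inE /= te /=; apply/mem_set; split => //=.
    rewrite in_itv /= ler_pdivrMr // ltr_pdivlMr //; exact: floor_itv.
  rewrite !inE /= => /andP[te /set_mem[_]]; rewrite /= in_itv /=.
  rewrite ler_pdivrMr // ltr_pdivlMr // => h; exists t => //.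
  by apply/esym/floor_def.
(* The code is [c] when no cell of any pair contradicts it, that is, is hit exactly when [c] says
   otherwise. *)
have -> : [set x | grid_code N x = c] =
    \bigcap_(e in [set: vpair 'I_n]) ~` \bigcup_(i : int)
      (npoints (L^~ e) (W i) @^-1` hit_set (i \notin c e)).
  apply/seteqP; split => [x /= <- e _ [i _ /=] /hit_setP|x /= xc].
    by rewrite -codeP; case: (_ \in _).
  apply/ffunP => e; apply/fsetP => i; rewrite codeP.
  have /(_ I) := xc e; case: (boolP (e \in _)) => h; case: (boolP (i \in c e)) => h' //.
    by move=> []; exists i => //; apply/hit_setP; rewrite h h'.
  by move=> []; exists i => //; apply/hit_setP; rewrite (negPf h) h'.
apply: fin_bigcap_measurable => [|e _]; first exact: finite_finset.
apply: measurableC; apply: countable_bigcupT_measurable => // i.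
apply: (measurable_hit hL); last exact: subIsetl.
exact: measurableI.
Qed.

Lemma measurable_has_optimal_spanner :
  measurable [set x | has_optimal_spanner (tgraph_of_labels (L x))].
Proof.
pose opt (c : {ffun vpair 'I_n -> {fset int}}) : Prop :=
  has_optimal_spanner (tgraph_of_labels
    (fun e => [fset (i%:~R : R) | i in c e]%fset)).
have gridE N x : grid_labels N (L x) =
    (fun e => [fset (i%:~R : R) | i in grid_code N x e]%fset).
  apply: funext => e; rewrite ffunE; apply/fsetP => r.
  apply/imfsetP/imfsetP => [[t /= te ->]|[_ /= /imfsetP[t /= te ->] ->]].
    by exists (Num.floor (t * N.+1%:R)) => //; exact: in_imfset.
  by exists t.
have -> : [set x | has_optimal_spanner (tgraph_of_labels (L x))] =
    \bigcup_N0 \bigcap_(N in [set N | (N0 <= N)%N])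
    \bigcup_(c in opt) [set x | grid_code N x = c].
  apply/seteqP; split => [x /= /has_optimal_spanner_grid[N0 H]|x [N0 _ H]].
    exists N0 => // N /= /H; rewrite gridE => o.
    by exists (grid_code N x).
  apply/has_optimal_spanner_grid; exists N0 => N /H [c oc /= xc].
  by rewrite gridE xc.
apply: bigcupT_measurable => N0; apply: bigcap_measurableType => N _.
rewrite bigcup_mkcond; apply: countable_bigcupT_measurable => // c.
by case: ifP => _ //; exact: measurable_grid_code.
Qed.

End SpannerMeasurable.

(** * Disjointness and hitting probabilities of the cells *)

Section Windows.
Context {R : realType}.
Implicit Types (Ws : seq (set R)) (D : set R) (x y delta : R).

Lemma windows_sub Ws D D' : D `<=` D' -> windows Ws D -> windows Ws D'.
Proof. by move=> DD [m s t]; split => // i; exact: subset_trans (s i) DD. Qed.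

Lemma windows_cat Ws Ws' D D' : D `&` D' = set0 ->
  windows Ws D -> windows Ws' D' -> windows (Ws ++ Ws') (D `|` D').
Proof.
move=> DD [m s t] [m' s' t']; split => [i|i|i j ij]; rewrite !nth_cat.
- by case: ifP.
- by case: ifP => _ z; [move=> /s; left|move=> /s'; right].
- case: ltnP => iW; case: ltnP => jW; [exact: t| |lia|apply: t'; lia].
  rewrite -subset0 => z [/s Dz /s' D'z].
  by have : (D `&` D') z by []; rewrite DD.
Qed.

Lemma windows1 x y : windows [:: `[x, y[%classic] `[x, y[.
Proof.
split => [[|i]|[|i]|[|i] [|j]] //=; rewrite ?nth_nil //.
- by move=> _; rewrite setI0.
- by move=> _; rewrite set0I.
Qed.

Lemma itv_co_disjoint x y x' y' : y <= x' -> `[x, y[ `&` `[x', y'[ = set0 :> set R.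
Proof.
move=> yx; rewrite -subset0 => t [] /=; rewrite !in_itv /= => /andP[_ h] /andP[h' _].
by have := lt_le_trans h (le_trans yx h'); rewrite ltxx.
Qed.

Lemma windows_out_cells x delta i0 M : 0 <= delta ->
  windows (out_cells x delta i0 M)
    `[x + i0%:R * delta, x + (i0 + M)%:R * delta[.
Proof.
move=> d0; elim: M i0 => [|M IH] i0.
  by split => [i|i|i j _]; rewrite /= !nth_nil ?set0I.
have le1 : x + i0%:R * delta <= x + i0.+1%:R * delta.
  by rewrite lerD2l ler_wpM2r // ler_nat.
have le2 : x + i0.+1%:R * delta <= x + (i0 + M.+1)%:R * delta.
  by rewrite lerD2l ler_wpM2r // ler_nat addnS ltnS leq_addr.
rewrite /out_cells /= -cat1s; apply: (windows_sub _ (windows_cat _ (windows1 _ _) (IH i0.+1))).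
  move=> t [] /=; rewrite !in_itv /= => /andP[a b].
    by rewrite a (lt_le_trans b).
  by rewrite (le_trans le1 a) -addSnnS.
exact: itv_co_disjoint.
Qed.

Lemma windows_in_cells y delta i0 M : 0 <= delta ->
  windows (in_cells y delta i0 M)
    `[y - (i0 + M)%:R * delta, y - i0%:R * delta[.
Proof.
move=> d0; elim: M i0 => [|M IH] i0.
  by split => [i|i|i j _]; rewrite /= !nth_nil ?set0I.
have le1 : y - i0.+1%:R * delta <= y - i0%:R * delta.
  by rewrite lerD2l lerN2 ler_wpM2r // ler_nat.
have le2 : y - (i0 + M.+1)%:R * delta <= y - i0.+1%:R * delta.
  by rewrite lerD2l lerN2 ler_wpM2r // ler_nat addnS ltnS leq_addr.
rewrite /in_cells /= -cat1s; apply: (windows_sub _ (windows_cat _ (windows1 _ _) (IH i0.+1))).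
  move=> t [] /=; rewrite !in_itv /= => /andP[a b].
    by rewrite b (le_trans le2).
  by rewrite (lt_le_trans b le1) andbT -addSnnS.
by rewrite setIC; exact: itv_co_disjoint.
Qed.

Lemma hit_prob_itv x y : x <= y -> hit_prob `[x, y[%classic = 1 - expR (- (y - x)).
Proof.
rewrite /hit_prob lebesgue_measure_itv /= lte_fin le_eqVlt => /predU1P[->|xy].
  by rewrite ltxx /= subrr.
by rewrite xy.
Qed.

Lemma hit_prob_out_cells x delta i0 M : 0 <= delta ->
  map hit_prob (out_cells x delta i0 M) = nseq M (1 - expR (- delta)).
Proof.
move=> d0; elim: M i0 => [//|M IH] i0; rewrite /= IH; congr cons.
rewrite hit_prob_itv -?natr1; last by rewrite lerD2l ler_wpM2r // lerDl.
by congr (1 - expR (- _)); ring.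
Qed.

Lemma hit_prob_in_cells y delta i0 M : 0 <= delta ->
  map hit_prob (in_cells y delta i0 M) = nseq M (1 - expR (- delta)).
Proof.
move=> d0; elim: M i0 => [//|M IH] i0; rewrite /= IH; congr cons.
rewrite hit_prob_itv -?natr1; last by rewrite lerD2l lerN2 ler_wpM2r // lerDl.
by congr (1 - expR (- _)); ring.
Qed.

End Windows.

(** * Candidate 4-cycles across four vertex classes *)

Section FourParts.
Context (n : nat).
Local Notation N := (n %/ 4)%N.

Lemma part_subproof (k : 'I_4) (a : 'I_N) : (4 * a + k < n)%N.
Proof. by have := ltn_ord a; have := ltn_ord k; lia. Qed.

(** Residue classes modulo 4 give four disjoint classes of size [N], so the four vertices of a
    candidate cycle are distinct. *)
Definition part (k : 'I_4) (a : 'I_N) : 'I_n := Ordinal (part_subproof k a).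

Lemma part_inj k k' a a' : part k a = part k' a' -> k = k' /\ a = a'.
Proof.
move=> /(congr1 val) /= h; have := ltn_ord k; have := ltn_ord k'.
by split; apply: val_inj => /=; lia.
Qed.

Lemma part_edge_subproof (k k' : 'I_4) (kk : k != k') a b :
  #|[set part k a; part k' b]%SET| == 2%N.
Proof.
rewrite cards2 (_ : part k a != part k' b) //; apply/eqP => /part_inj[/eqP].
by rewrite (negPf kk).
Qed.

Definition part_edge (k k' : 'I_4) (kk : k != k') a b : vpair 'I_n :=
  exist _ [set part k a; part k' b]%SET (part_edge_subproof kk a b).

Lemma part_edge_inj k k' (kk : k != k') a b a' b' :
  part_edge kk a b = part_edge kk a' b' -> a = a' /\ b = b'.
Proof.
move=> /(congr1 val) /= /setP h; move: (h (part k a)) (h (part k' b)).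
rewrite !inE !eqxx orbT /= => /esym/orP[/eqP/part_inj[_ ->]|/eqP/part_inj[/eqP]];
  last by rewrite (negPf kk).
move=> /esym/orP[/eqP/part_inj[/eqP]|/eqP/part_inj[_ ->]] //.
by rewrite eq_sym (negPf kk).
Qed.

Let i0 : 'I_4 := @Ordinal 4 0 isT.
Let i1 : 'I_4 := @Ordinal 4 1 isT.
Let i2 : 'I_4 := @Ordinal 4 2 isT.
Let i3 : 'I_4 := @Ordinal 4 3 isT.

Definition edge_ab := part_edge (isT : i0 != i1).
Definition edge_cd := part_edge (isT : i2 != i3).
Definition edge_bc := part_edge (isT : i1 != i2).
Definition edge_da := part_edge (isT : i3 != i0).

Definition cycle_set (i : 'I_N * 'I_N * ('I_N * 'I_N)) : {set 'I_n} :=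
  [set part i0 i.1.1; part i1 i.1.2; part i2 i.2.1; part i3 i.2.2]%SET.

Lemma cycle_uniq (i : 'I_N * 'I_N * ('I_N * 'I_N)) :
  uniq [:: part i0 i.1.1; part i1 i.1.2; part i2 i.2.1; part i3 i.2.2].
Proof.
have ne k k' a a' : k != k' -> (part k a == part k' a') = false.
  by move=> /eqP kk; apply/negP => /eqP /part_inj[].
by rewrite /= !inE !ne.
Qed.

Lemma card_cycle_set i : #|cycle_set i| = 4%N.
Proof.
rewrite -[4%N]/(size [:: part i0 i.1.1; part i1 i.1.2; part i2 i.2.1; part i3 i.2.2]).
by rewrite -(card_uniqP (cycle_uniq i)); apply: eq_card => z; rewrite !inE -!orbA.
Qed.

Definition cycle_layers (s : seq {set vpair 'I_n}) i : bool :=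
  is_cycle edge_ab edge_cd edge_bc edge_da s i.

(** The same cycle must serve as the start of both growths: [s1] gathers at it and [s2] broadcasts
    from it. *)
Definition good_layers (s0 s1 s2 : seq {set vpair 'I_n}) : bool :=
  [exists i, [&& cycle_layers s0 i, grow (cycle_set i) s1 == [set: 'I_n]%SET
    & grow (cycle_set i) s2 == [set: 'I_n]%SET]].

(** Here [tau] is the time at which gathering ends and the exchange on the cycle begins. *)
Lemma good_layers_spanner (R : realType) (l : vpair 'I_n -> {fset R})
    (tau w delta : R) (M : nat) : 0 <= w -> 0 <= delta ->
  good_layers (map (layer l) (out_cells tau w 0 4))
    (map (layer l) (in_cells tau delta 0 M))
    (map (layer l) (out_cells (tau + 4 * w) delta 0 M)) ->
  has_optimal_spanner (tgraph_of_labels l).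
Proof.
move=> w0 d0 /existsP[i /and3P[/and4P[/= h1 h2 h3 h4] /eqP g1 /eqP g2]].
have [t1 l1 b1] := mem_layer h1; have [t2 l2 b2] := mem_layer h2.
have [t3 l3 b3] := mem_layer h3; have [t4 l4 b4] := mem_layer h4.
have ps : partial_spanner l (cycle_set i) (cycle_set i) (tau + 0%:R * w)
    (tau + 4%:R * w).
  by apply: (partial_spanner_cycle (cycle_uniq i) _ _ _ _ l1 l2 l3 l4 b1 b2 b3 b4).
have c4 : (4 <= #|cycle_set i| + #|cycle_set i|)%N by rewrite card_cycle_set.
have ps1 : partial_spanner l (cycle_set i) (cycle_set i) (tau - 0%:R * delta)
    (tau + 4 * w + 0%:R * delta).
  by apply: partial_spanner_weaken ps; rewrite !mul0r ?subr0 ?addr0.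
have ps2 := partial_spanner_grow_out M d0 c4 ps1.
rewrite g2 in ps2.
have c4' : (4 <= #|cycle_set i| + #|[set: 'I_n]%SET|)%N.
  by rewrite card_cycle_set leq_addr.
have := partial_spanner_grow_in M d0 c4' ps2; rewrite g1.
exact: partial_spanner_full.
Qed.

End FourParts.

(** * Union bound over the ways to fail *)

Section BadLayers.
Context {R : realType} (n : nat).
Local Notation N := (n %/ 4)%N.

Lemma expect_bad_layers (q delta beta : R) (M : nat) : (4 <= n)%N ->
  q <= 1 -> 1 <= N%:R * q -> 0 <= delta ->
  0 <= 1 - @growth_rate R 'I_n delta ->
  (n%:R - 2) * (1 - @growth_rate R 'I_n delta) ^+ M *
    @potential R 'I_n 4 <= beta ->
  expect (nseq 4 q) (fun s0 =>
    expect (nseq M (1 - expR (- delta))) (fun s1 =>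
    expect (nseq M (1 - expR (- delta))) (fun s2 =>
      (~~ @good_layers n s0 s1 s2)%:R))) <= 9 / (N%:R * q) + 2 * beta.
Proof.
move=> n4 q1 Nq d0 r0 hb; set qs := nseq M _.
have q0 : 0 <= q.
  rewrite leNgt; apply/negP => q0.
  by have : N%:R * q <= 0; [rewrite mulr_ge0_le0 // ltW|lra].
have pq : probs (nseq 4 q).
  by apply/allP => x; rewrite mem_nseq => /andP[_ /eqP ->]; rewrite q0.
have pqs : probs qs.
  apply/allP => x; rewrite mem_nseq => /andP[_ /eqP ->].
  by rewrite subr_ge0 expR_le1 oppr_le0 d0 /= lerBlDr lerDl expR_ge0.
have fail i : expect qs (fun s => (grow (@cycle_set n i) s != [set: 'I_n]%SET)%:R)
    <= beta.
  apply: le_trans _ hb; apply: le_trans (expect_grow_failure _ _ _ _) _ => //.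
    by rewrite card_cycle_set.
  by rewrite card_cycle_set card_ord.
have beta0 : 0 <= beta.
  apply: le_trans _ hb; apply: mulr_ge0; last by rewrite potential_ge0 // card_ord.
  by rewrite mulr_ge0 ?exprn_ge0 // subr_ge0 ler_nat (leq_trans _ n4).
have cyc := no_cycle_le (@part_edge_inj n _ _ _) (@part_edge_inj n _ _ _)
  (@part_edge_inj n _ _ _) (@part_edge_inj n _ _ _) q1 Nq.
apply: (@le_trans _ _ (expect (nseq 4 q) (fun s0 =>
  (~~ [exists i, @cycle_layers n s0 i])%:R + 2 * beta))); last first.
  rewrite expectD expect_cst lerD2r; exact: cyc.
(* The cycle layers are fixed first. If they contain a cycle, one such cycle is kept, and its two
   growths use independent layers with a bound that is the same for all cycles. *)
apply: le_expect => // s0 _; case: existsP => [[i ci]|_] /=; last first.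
  apply: (@le_trans _ _ 1); last by rewrite lerDl mulr_ge0.
  rewrite -[leRHS](expect_cst (E := vpair 'I_n) qs 1); apply: le_expect => // s1 _.
  rewrite -[leRHS](expect_cst (E := vpair 'I_n) qs 1); apply: le_expect => // s2 _.
  by case: (~~ _).
rewrite add0r mulr_natl mulr2n.
apply: (@le_trans _ _ (expect qs (fun s1 =>
  (grow (cycle_set i) s1 != [set: 'I_n]%SET)%:R + beta))).
  apply: le_expect => // s1 _.
  apply: (@le_trans _ _ (expect qs (fun s2 =>
    (grow (cycle_set i) s1 != [set: 'I_n]%SET)%:R +
    (grow (cycle_set i) s2 != [set: 'I_n]%SET)%:R))).
    apply: le_expect => // s2 _; rewrite -natrD ler_nat.
    case: (boolP (good_layers s0 s1 s2)) => //= /existsPn/(_ i).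
    by rewrite ci /= negb_and; do 2 case: eqP.
  by rewrite expectD expect_cst lerD2l; exact: fail.
by rewrite expectD expect_cst lerD2r; exact: fail.
Qed.

End BadLayers.

(** * Lower bound on the probability of an optimal spanner *)

Section SpannerProbability.
Context {R : realType} (d : measure_display) (T : measurableType d)
  (P : probability T R) (n : nat) (p : R).
Context (L : T -> vpair 'I_n -> {fset R}).
Hypothesis hL : random_labels_H P p L.

Lemma prob_optimal_spanner_ge (tau w delta beta : R) (M : nat) : (4 <= n)%N ->
  0 <= w -> 0 <= delta -> tau = M%:R * delta -> 2 * tau + 4 * w <= p ->
  1 <= (n %/ 4)%:R * (1 - expR (- w)) ->
  0 <= 1 - @growth_rate R 'I_n delta ->
  (n%:R - 2) * (1 - @growth_rate R 'I_n delta) ^+ M *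
    @potential R 'I_n 4 <= beta ->
  ((1 - (9 / ((n %/ 4)%:R * (1 - expR (- w))) + 2 * beta))%:E <=
   P [set x | has_optimal_spanner (tgraph_of_labels (L x))])%E.
Proof.
move=> n4 w0 d0 tauE taup Nq r0 hb.
pose Ws0 := out_cells tau w 0 4.
pose Ws1 := in_cells tau delta 0 M.
pose Ws2 := out_cells (tau + 4 * w) delta 0 M.
have tau0 : 0 <= tau by rewrite tauE mulr_ge0.
(* The cycle windows come first in the list, though not in time, so that the expectation conditions
   on the cycle before the growths. *)
have hW : windows (Ws0 ++ (Ws1 ++ Ws2)) `[0, p].
  apply: (windows_sub _ (windows_cat _ (windows_out_cells tau 0 4 w0)
    (windows_cat _ (windows_in_cells tau 0 M d0)
      (windows_out_cells (tau + 4 * w) 0 M d0)))).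
  - rewrite !add0n -tauE subrr !mul0r !addr0 subr0.
    by move=> t [|[]] /=; rewrite !in_itv /= => /andP[a b]; apply/andP; split; lra.
  - rewrite setIUr setIC itv_co_disjoint ?set0U ?itv_co_disjoint //; lra.
  - apply: itv_co_disjoint; lra.
pose good (s : seq {set vpair 'I_n}) : bool :=
  good_layers (take 4 s) (take M (drop 4 s)) (drop M (drop 4 s)).
have [mG PG] := prob_layers hL good hW.
have sub : [set x | good (map (layer (L x)) (Ws0 ++ (Ws1 ++ Ws2)))] `<=`
    [set x | has_optimal_spanner (tgraph_of_labels (L x))].
  move=> x gx; have : good (map (layer (L x)) (Ws0 ++ (Ws1 ++ Ws2))) := gx.
  rewrite /good !map_cat.
  rewrite take_size_cat // drop_size_cat //.
  have sz : size (map (layer (L x)) Ws1) = M by rewrite !size_map size_iota.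
  by rewrite take_size_cat // drop_size_cat //; exact: good_layers_spanner.
have mE := measurable_has_optimal_spanner hL.
have le1 : (P [set x | good (map (layer (L x)) (Ws0 ++ (Ws1 ++ Ws2)))] <=
    P [set x | has_optimal_spanner (tgraph_of_labels (L x))])%E.
  exact: le_measure (mem_set mG) (mem_set mE) sub.
rewrite PG in le1; apply: le_trans _ le1; rewrite lee_fin !map_cat hit_prob_out_cells // hit_prob_in_cells //.
rewrite hit_prob_out_cells //.
set q := 1 - expR (- w); set qs := nseq M _.
have -> : expect (nseq 4 q ++ (qs ++ qs)) (fun s => (good s)%:R) =
    1 - expect (nseq 4 q ++ (qs ++ qs)) (fun s => (~~ good s)%:R).
  apply/esym/eqP; rewrite subr_eq -expectD; apply/eqP.
  rewrite -[LHS](expect_cst (E := vpair 'I_n) (nseq 4 q ++ (qs ++ qs)) 1).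
  by apply: eq_expect => s _; case: (good s); rewrite /= ?addr0 ?add0r.
rewrite lerD2l lerN2; apply: le_trans (expect_bad_layers n4 _ Nq d0 r0 hb).
  rewrite expect_cat le_eqVlt; apply/orP; left; apply/eqP.
  apply: eq_expect => s0 ss0; rewrite expect_cat.
  apply: eq_expect => s1 ss1; apply: eq_expect => s2 ss2; rewrite /good.
  by rewrite take_size_cat // drop_size_cat // take_size_cat ?drop_size_cat //
    ss1 size_nseq.
by rewrite lerBlDr lerDl expR_ge0.
Qed.

End SpannerProbability.

(** * Choice of parameters and limits *)

Section Asymptotics.
Context {R : realType}.

Lemma expRN_le_inv (x : R) : 0 < x -> expR (- x) <= x^-1.
Proof.
move=> x0; rewrite expRN lef_pV2 ?posrE ?expR_gt0 //.
by apply: le_trans (expR_ge1Dx x); rewrite lerDr.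
Qed.

Lemma one_sub_expRN_ge (x : R) : 0 <= x <= 1 -> x / 2 <= 1 - expR (- x).
Proof.
move=> /andP[x0 x1].
have : expR (- x) <= (1 + x)^-1.
  by rewrite expRN lef_pV2 ?posrE ?expR_gt0 ?expR_ge1Dx //; lra.
have : (1 + x)^-1 <= 1 - x / 2.
  by rewrite -[leLHS]mul1r ler_pdivrMr; nra.
lra.
Qed.

(** With 8 n^3 cells delta n^2 <= 1/n, so the total rate is at least A (n - 1)/(n + 1) = A - 2A/(n +
    1), hence at least A - 16 because A <= 8n. *)
Lemma growth_failure_le (n : nat) (A delta : R) :
  (4 <= n)%N -> 0 <= A <= 8 * n%:R ->
  delta = A / n%:R / (8 * n ^ 3)%:R ->
  0 <= 1 - @growth_rate R 'I_n delta /\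
  (n%:R - 2) * (1 - @growth_rate R 'I_n delta) ^+ (8 * n ^ 3) *
    @potential R 'I_n 4 <= n%:R ^+ 2 * expR (16 - A).
Proof.
move=> n4 /andP[A0 A8] dE; rewrite /growth_rate card_ord.
set x := n%:R : R; have x4 : 4 <= x by rewrite ler_nat.
have x0 : 0 < x by lra.
have x30 : 0 < x ^+ 3 by rewrite exprn_gt0.
have ME : (8 * n ^ 3)%:R = 8 * x ^+ 3 by rewrite natrM natrX.
have d0 : 0 <= delta by rewrite dE ME !divr_ge0 // ?mulr_ge0 // ltW.
have dx : delta * x ^+ 2 <= x^-1.
  rewrite -[leRHS]mul1r ler_pdivlMr // -mulrA -exprSr dE ME.
  rewrite -ler_pdivlMr // ler_pdivrMr ?mulr_gt0 // ler_pdivrMr //.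
  apply: le_trans A8 _; rewrite le_eqVlt; apply/orP; left; apply/eqP; field.
  exact: lt0r_neq0.
have dx2 : 0 <= delta * x ^+ 2 by rewrite mulr_ge0 // exprn_ge0 // ltW.
set kap := (x - 1) * delta / (1 + delta * x ^+ 2).
have kap1 : kap <= 1.
  rewrite /kap ler_pdivrMr; last lra.
  have : (x - 1) * delta <= delta * x ^+ 2 by rewrite mulrC ler_wpM2l //; nra.
  lra.
split; first by rewrite subr_ge0.
have kM : A - 16 <= (8 * n ^ 3)%:R * kap.
  have -> : (8 * n ^ 3)%:R * kap = (x - 1) * A / x / (1 + delta * x ^+ 2).
    rewrite /kap mulrA mulrCA.
    have -> : (8 * n ^ 3)%:R * delta = A / x.
      by rewrite dE ME; field; rewrite lt0r_neq0.
    by rewrite !mulrA.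
  apply: (@le_trans _ _ ((x - 1) * A / x / (1 + x^-1))).
    have -> : (x - 1) * A / x / (1 + x^-1) = (x - 1) * A / (x + 1).
      by field; apply/andP; split; apply/eqP; lra.
    by rewrite ler_pdivlMr; nra.
  rewrite ler_wpM2l //; first by rewrite !mulr_ge0 ?invr_ge0 //; lra.
  have : 0 < x^-1 by rewrite invr_gt0.
  by move=> ?; rewrite lef_pV2 ?posrE; lra.
have pM : (1 - kap) ^+ (8 * n ^ 3) <= expR (16 - A).
  apply: (@le_trans _ _ (expR (- kap) ^+ (8 * n ^ 3))).
    by rewrite lerXn2r ?nnegrE ?subr_ge0 ?expR_ge0 // expR_ge1Dx.
  by rewrite -expRM_natl ler_expR mulrN; lra.
rewrite /potential card_ord -/x mulrAC.
have pot : (x - 4%:R) / (4%:R - 1) <= x by rewrite ler_pdivrMr; lra.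
have pot0 : 0 <= (x - 4%:R) / (4%:R - 1) by rewrite divr_ge0; lra.
apply: ler_pM => //.
- by rewrite mulr_ge0 //; lra.
- by rewrite exprn_ge0 // subr_ge0.
- by rewrite expr2; apply: ler_pM => //; lra.
Qed.

(** The quantity l of the overview; [eps] is 16 [slack n] / n. *)
Definition slack (n : nat) : R := (ln n%:R) `^ (8 / 10).

Lemma slack_le_ln n : 1 < slack n -> slack n <= ln n%:R.
Proof.
move=> s1; have ln1 : 1 <= ln (n%:R : R).
  rewrite leNgt; apply/negP => l1; move: s1; rewrite ltNge => /negP; apply.
  have [l0|l0] := leP 0 (ln (n%:R : R)).
    have <- : 1 `^ (8 / 10) = 1 :> R by rewrite powR1.
    by apply: ge0_ler_powR; rewrite ?nnegrE //; lra.
  by rewrite /slack lt0_powR1.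
rewrite /slack -[leRHS]powRr1; last lra.
by apply: ler_powR => //; lra.
Qed.

Lemma slack_unbounded (A : R) : 0 < A -> \forall n \near \oo, A <= slack n.
Proof.
move=> A0; near=> n.
(* The exponent 10/8 inverts 8/10. *)
have n0 : expR (A `^ (10 / 8)) <= n%:R by near: n; exact: nbhs_infty_ger.
have l0 : A `^ (10 / 8) <= ln n%:R.
  rewrite -[leLHS]expRK ler_ln ?posrE ?expR_gt0 //.
  exact: lt_le_trans (expR_gt0 _) n0.
have AE : (A `^ (10 / 8)) `^ (8 / 10) = A.
  have e : 10 / 8 * (8 / 10) = 1 :> R by field.
  by rewrite -powRrM e powRr1 // ltW.
have ln0 := le_trans (powR_ge0 _ _) l0.
by rewrite -[leLHS]AE; apply: ge0_ler_powR; rewrite ?nnegrE ?powR_ge0 //; lra.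
Unshelve. all: by end_near. Qed.

Lemma prob_optimal_spanner_ge_slack (d : measure_display) (T : measurableType d)
    (P : probability T R) (n : nat) (p : R) (L : T -> vpair 'I_n -> {fset R}) :
  random_labels_H P p L -> 16 <= slack n ->
  4 * ln n%:R / n%:R + eps R n <= p ->
  ((1 - 145 / slack n)%:E <=
   P [set x | has_optimal_spanner (tgraph_of_labels (L x))])%E.
Proof.
rewrite /eps -/(slack n) => hL; set l := slack n => l16 hp.
have ll : l <= ln n%:R by apply: slack_le_ln; rewrite -/l; lra.
have n0 : (0 < n)%N.
  (* For n = 0 the default value [ln 0 = 0] would be at least l. *)
  rewrite lt0n; apply: contraTneq ll => n0; rewrite -ltNge n0 ln0 //; lra.
set x := n%:R : R; have x0 : 0 < x by rewrite ltr0n.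
have lnx : ln x < x by exact: ln_sublinear.
rewrite -/x in hp ll.
have x16 : 16 <= x by lra.
have n4 : (4 <= n)%N by rewrite -(ler_nat R) -/x; lra.
(* Two windows of length A/x and four of length l/x take (4 ln x + 16 l)/x, exactly the guaranteed
   time. *)
pose A := 2 * ln x + 6 * l; pose M := (8 * n ^ 3)%N.
pose delta := A / x / M%:R; pose w := l / x.
have A0 : 0 <= A by rewrite /A; lra.
have A8 : A <= 8 * x by rewrite /A; lra.
have [r0 fail] := growth_failure_le n4 (introT andP (conj A0 A8)) (erefl delta).
have M0 : (0 < M)%N by rewrite muln_gt0 expn_gt0 n0.
have M0' : M%:R != 0 :> R by rewrite pnatr_eq0 -lt0n.
have w01 : 0 <= w <= 1.
  by rewrite /w divr_ge0 ?(ltW x0) ?ler_pdivrMr //; lra.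
have N8 : x / 8 <= (n %/ 4)%:R.
  rewrite ler_pdivrMr // -natrM ler_nat; lia.
have Nq : l / 16 <= (n %/ 4)%:R * (1 - expR (- w)).
  have -> : l / 16 = (x / 8) * (w / 2) by rewrite /w; field; exact: lt0r_neq0.
  apply: ler_pM => //; [lra|by case/andP: w01 => *; lra|exact: one_sub_expRN_ge].
(* The left side is exp(16 - 6 l), at most exp(-5 l) since l >= 16. *)
have big : x ^+ 2 * expR (16 - A) <= (5 * l)^-1.
  have -> : x ^+ 2 = expR (2 * ln x) by rewrite expRM_natl lnK.
  rewrite -expRD; apply: (@le_trans _ _ (expR (- (5 * l)))).
    by rewrite ler_expR /A; lra.
  by apply: expRN_le_inv; lra.
have w0 : 0 <= w by case/andP: w01.
have d0 : 0 <= delta by rewrite /delta !divr_ge0 // ltW.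
apply: le_trans (prob_optimal_spanner_ge hL n4 w0 d0
  (tau := A / x) _ _ _ r0 (le_trans fail big)).
(* The cycle costs 144/l and the two growths 2/(5 l), together below 145/l. *)
- rewrite lee_fin lerD2l lerN2.
  have : 9 / ((n %/ 4)%:R * (1 - expR (- w))) <= 9 / (l / 16).
    by rewrite ler_pM2l // lef_pV2 ?posrE //; lra.
  have -> : 9 / (l / 16) = 144 / l by field; lra.
  have -> : (5 * l)^-1 = l^-1 / 5 by field; lra.
  have : 0 < l^-1 by rewrite invr_gt0; lra.
  lra.
- by rewrite [RHS]mulrC divfK.
- apply: le_trans hp; rewrite le_eqVlt; apply/orP; left; apply/eqP.
  by rewrite /A /w; field; exact: lt0r_neq0.
- by apply: le_trans Nq; lra.
Qed.

End Asymptotics.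

Theorem theorem6p13 (R : realType) (p : nat -> R)
    (hp : forall n : nat, (0 < n)%N ->
       4 * ln n%:R / n%:R + eps R n <= p n)
    (d : nat -> measure_display) (T : forall n, measurableType (d n))
    (P : forall n, probability (T n) R)
    (L : forall n, T n -> vpair 'I_n -> {fset R})
    (hL : forall n, random_labels_H (P n) (p n) (L n)) :
  aas P (fun n => [set x | has_optimal_spanner (tgraph_of_labels (L n x))]).
Proof.
have mE n := measurable_has_optimal_spanner (hL n).
split => //.
apply: (squeeze_cvge (f := fun n => (1 - 145 / slack n)%:E) (h := fun=> 1%E)).
- near=> n; rewrite probability_le1 // andbT.
  apply: prob_optimal_spanner_ge_slack (hL n) _ _.
    by near: n; exact: slack_unbounded.
  by apply: hp; near: n; exact: nbhs_infty_gt.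
- apply: cvg_EFin; first by near=> n.
  apply/cvgrPdist_le => e e0; near=> n => /=.
  have s0 : 145 / e <= slack n by near: n; apply: slack_unbounded; rewrite divr_gt0.
  have sp : 0 < slack n :> R by apply: lt_le_trans s0; rewrite divr_gt0.
  rewrite subKr ger0_norm ?divr_ge0 ?(ltW sp) //.
  by rewrite ler_pdivrMr // mulrC -ler_pdivrMr.
- exact: cvg_cst.
Unshelve. all: by end_near. Qed.
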